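(* For a poset $P$, we have $\operatorname{cw}(P) = |P|$ if and only if, writing $P=Q_1<\dots<Q_t$ for the block decomposition of $P$, $Q_t\in\mathbb{A}\cup\mathbb{B}\cup\{Z\}$ and, if $t>1$, every block of $P-Q_t$ (i.e., each of $Q_1,\dots,Q_{t-1}$) lies in $\mathbb{A}_{2,3,4}\cup\mathbb{B}\cup\{Z\}$.
   Context: All posets are finite with non-empty ground sets. An inclusion representation of $P$ is a family $\{S_x:x\in P\}$ with $x\le y$ iff $S_x\subseteq S_y$. $\operatorname{ch}(P)$ is the least $h$ such that $P$ has an inclusion representation with all $|S_x|\le h$; $\operatorname{cw}(P)$ is the least $w$ such that $P$ has an inclusion representation with ground set $\bigcup S_x$ of size $w$ and all $|S_x|\le\operatorname{ch}(P)$. The vertical sum $Q_1<\dots<Q_t$ has $x\le y$ iff $x,y\in Q_i$ with $x\le y$ in $Q_i$, or $x\in Q_i,y\in Q_j$, $i<j$. A block is a chain or a poset that is not a vertical sum of two non-empty posets; the block decomposition is $P$ itself if $P$ is a block, otherwise $P=Q_1<\dots<Q_t$ with least $t\ge2$ and all $Q_i$ blocks. $Z$ is the four-element poset with three components; $\mathbb{A}$ is the set of antichains with at least two elements; $\mathbb{A}_{2,3,4}$ the antichains of sizes 2, 3, 4; $\mathbb{B}$ the posets $C+T$ (disjoint sum) with $C$ a chain of at least two elements and $T$ a one-element poset. *)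

(* Defs.v *)
From mathcomp Require Import all_boot all_order.
From mathcomp Require Import boolp.

Set Implicit Arguments.
Unset Strict Implicit.
Unset Printing Implicit Defensive.

Import Order.TTheory.

Local Open Scope order_scope.

Section InclusionRepresentation.
Context {d : Order.disp_t} (P : finPOrderType d).

Definition inclusion_rep (U : finType) (S : P -> {set U}) : Prop :=
  forall x y : P, (x <= y) = (S x \subset S y).

(* Letting the sets live in a finite type [U] loses nothing: [P] is finite and
   only representations by sets of bounded finite size are considered. *)
Definition rep_of_height (h : nat) : Prop :=
  exists (U : finType) (S : P -> {set U}),
    inclusion_rep S /\ (forall x, (#|S x| <= h)%N).

Lemma rep_of_height_ex : exists h, `[< rep_of_height h >].
Proof.
exists #|P|; apply/asboolP; exists P, (fun x => [set z | z <= x]); split.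
  move=> x y; apply/idP/subsetP => [xy z|]; first by rewrite !inE => /le_trans; apply.
  by move/(_ x); rewrite !inE; apply.
by move=> x; apply: max_card.
Qed.

Definition ch : nat := ex_minn rep_of_height_ex.

Definition rep_of_width (w : nat) : Prop :=
  exists (U : finType) (S : P -> {set U}),
    [/\ inclusion_rep S, forall x, (#|S x| <= ch)%N & #|\bigcup_x S x| = w].

Lemma rep_of_width_ex : exists w, `[< rep_of_width w >].
Proof.
rewrite /rep_of_width /ch; case: ex_minnP => h /asboolP[U [S [Srep Sh]]] _.
by exists #|\bigcup_x S x|; apply/asboolP; exists U, S.
Qed.

Definition cw : nat := ex_minn rep_of_width_ex.

End InclusionRepresentation.

(* A subset of [P] stands for the subposet of [P] that it induces. *)
Section Subposets.
Context {d : Order.disp_t} {P : finPOrderType d}.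
Implicit Types (A B C : {set P}) (Q : seq {set P}).

Definition is_chain A : Prop := {in A &, forall x y, x >=< y}.

Definition is_antichain A : Prop := {in A &, forall x y, x <= y -> x = y}.

(* [A] is the vertical sum of the non-empty posets listed, from bottom to top,
   in [Q]. *)
Definition vertical_sum A Q : Prop :=
  [/\ A = \bigcup_(B <- Q) B,
      set0 \notin Q,
      pairwise (fun B C => [disjoint B & C]) Q &
      {in A &, forall x y, x <= y <->
         (exists i, [/\ (i < size Q)%N, x \in nth set0 Q i,
                        y \in nth set0 Q i & x <= y])
         \/ (exists i j, [/\ (i < j < size Q)%N, x \in nth set0 Q i &
                             y \in nth set0 Q j])}].

Definition is_block A : Prop :=
  is_chain A \/ ~ (exists B C, vertical_sum A [:: B; C]).

Definition sum_of_blocks A Q : Prop :=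
  vertical_sum A Q /\ {in Q, forall B, is_block B}.

Definition block_decomposition Q : Prop :=
  (is_block [set: P] /\ Q = [:: [set: P]])
  \/ (~ is_block [set: P] /\
      [/\ (2 <= size Q)%N, sum_of_blocks [set: P] Q &
          forall Q', (2 <= size Q')%N -> sum_of_blocks [set: P] Q' ->
            (size Q <= size Q')%N]).

(* Number of connected components of the comparability graph of [A]. *)
Definition num_components A : nat :=
  n_comp [rel x y | [&& x \in A, y \in A & x >=< y]] A.

Definition in_Z A : Prop := #|A| = 4 /\ num_components A = 3.

Definition in_A A : Prop := is_antichain A /\ (2 <= #|A|)%N.

Definition in_A234 A : Prop := is_antichain A /\ (2 <= #|A| <= 4)%N.

Definition in_B A : Prop :=
  exists C t, [/\ A = t |: C, is_chain C, (2 <= #|C|)%N, t \notin C &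
                  {in C, forall x, x >< t}].

Lemma vertical_sumP A Q : vertical_sum A Q <->
  [/\ A = \bigcup_(B <- Q) B, set0 \notin Q &
      pairwise (fun B C => [forall x in B, forall y in C, x < y]) Q].
Proof.
have sub i : (i < size Q)%N -> nth set0 Q i \subset \bigcup_(B <- Q) B.
  by move=> iQ; rewrite (big_nth set0) big_mkord (bigcup_sup (Ordinal iQ)).
have mem x : x \in \bigcup_(B <- Q) B ->
    exists2 i, (i < size Q)%N & x \in nth set0 Q i.
  rewrite (big_nth set0) big_mkord => /bigcupP[i _ xi].
  by exists i.
split=> [[-> Q0 /(pairwiseP set0) dj ord]|[-> Q0 /(pairwiseP set0) lt]].
  split=> //; apply/(pairwiseP set0) => i j iQ jQ ij.
  apply/forall_inP => x xi; apply/forall_inP => y yj.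
  have xA := subsetP (sub _ iQ) _ xi; have yA := subsetP (sub _ jQ) _ yj.
  rewrite lt_neqAle; apply/andP; split.
    apply/eqP => xy; have /disjointFr := dj _ _ iQ jQ ij.
    by move/(_ _ xi); rewrite xy yj.
  by apply/ord => //; right; exists i, j; rewrite ij.
have {}lt i j x y : (i < j < size Q)%N -> x \in nth set0 Q i ->
    y \in nth set0 Q j -> x < y.
  case/andP=> ij jQ xi yj.
  by have /forall_inP/(_ x xi)/forall_inP/(_ y yj) :=
    lt _ _ (ltn_trans ij jQ) jQ ij.
split=> //.
  apply/(pairwiseP set0) => i j iQ jQ ij; rewrite disjoint_subset.
  apply/subsetP=> x xi; rewrite inE; apply/negP => xj.
  have ijQ : (i < j < size Q)%N by rewrite ij.
  by have := lt _ _ _ _ ijQ xi xj; rewrite ltxx.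
move=> x y /mem[i iQ xi] /mem[j jQ yj]; split=> [xy|].
  case: (ltngtP i j) => [ij|ji|ij].
  - by right; exists i, j; rewrite ij.
  - have jiQ : (j < i < size Q)%N by rewrite ji.
    by have := le_lt_trans xy (lt _ _ _ _ jiQ yj xi); rewrite ltxx.
  - by left; exists i; split=> //; rewrite ij.
by case=> [[k []]//|[k [l [kl xk yl]]]]; apply/ltW/(lt _ _ _ _ kl xk yl).
Qed.

Lemma sum_of_blocks_ex A : A != set0 -> exists Q, sum_of_blocks A Q.
Proof.
have [n] := ubnP #|A|; elim: n A => // n IHn A /ltnSE leAn A0.
have [blA|/not_orP[_ /contrapT[B [C /vertical_sumP[]]]]] :=
  pselect (is_block A).
  exists [:: A]; split; last by move=> B; rewrite inE => /eqP->.
  by apply/vertical_sumP; rewrite big_seq1 inE eq_sym.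
rewrite big_cons big_seq1 !inE negb_or ![set0 == _]eq_sym /= !andbT => defA.
case/andP=> B0 C0 /forall_inP ltBC.
have djBC : [disjoint B & C].
  rewrite disjoint_subset; apply/subsetP => x xB; rewrite inE.
  by apply/negP => xC; have /forall_inP/(_ x xC) := ltBC x xB; rewrite ltxx.
have cA : #|A| = (#|B| + #|C|)%N.
  by rewrite defA; apply/eqP; rewrite (leq_card_setU B C).2.
have [Q1 [/vertical_sumP[d1 z1 p1] b1]] : exists Q, sum_of_blocks B Q.
  apply: IHn => //; apply: leq_trans leAn.
  by rewrite cA -addn1 leq_add2l card_gt0.
have [Q2 [/vertical_sumP[d2 z2 p2] b2]] : exists Q, sum_of_blocks C Q.
  apply: IHn => //; apply: leq_trans leAn.
  by rewrite cA -add1n leq_add2r card_gt0.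
have sub Q D : D \in Q -> D \subset \bigcup_(B <- Q) B.
  by move=> DQ; rewrite (big_rem D) //= subsetUl.
exists (Q1 ++ Q2); split; last first.
  by move=> D; rewrite mem_cat => /orP[/b1|/b2].
apply/vertical_sumP; rewrite big_cat /= -d1 -d2 mem_cat negb_or z1 z2.
split=> //; rewrite pairwise_cat p1 p2 !andbT.
apply/allrelP => D E /sub + /sub; rewrite -d1 -d2 => /subsetP sD /subsetP sE.
apply/forall_inP => x /sD xB; apply/forall_inP => y /sE yC.
by have /forall_inP/(_ y yC) := ltBC x xB.
Qed.

Lemma block_decomposition_ex :
  (0 < #|P|)%N -> exists Q, block_decomposition Q.
Proof.
move=> P0; have [blP|nblP] := pselect (is_block [set: P]).
  by exists [:: [set: P]]; left.
have exQ : exists n, `[< exists Q,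
    [/\ size Q = n, (2 <= n)%N & sum_of_blocks [set: P] Q] >].
  have [|Q sQ] := @sum_of_blocks_ex [set: P]; first by rewrite -card_gt0 cardsT.
  exists (size Q); apply/asboolP; exists Q; split=> //.
  case: Q sQ => [|B [|C Q]]// [[defP _ _ _] bl].
    by move: P0; rewrite -cardsT defP big_nil cards0.
  by case: nblP; rewrite defP big_seq1; apply: bl; rewrite inE.
case: (ex_minnP exQ) => n /asboolP[Q [szQ n2 sQ]] minQ.
exists Q; right; split=> //; split; rewrite ?szQ// => Q' Q'2 sQ'.
by apply: minQ; apply/asboolP; exists Q'.
Qed.

End Subposets.

(* Main.v *)
Require Import Defs.
From mathcomp Require Import all_boot all_order.
From mathcomp Require Import boolp zify.

Set Implicit Arguments.
Unset Strict Implicit.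
Unset Printing Implicit Defensive.

Import Order.TTheory.

(* Two facts drive the proof.  First, a Hall-type exchange: in any
   representation S choose Y maximizing |Y| - |N(Y)|, keep the symbols N(Y) used
   on Y and replace all others by the down-sets of the elements outside Y.  No
   set grows and at most |P| symbols remain; if cw(P) = |P| this forces every
   representation of height at most ch(P) to satisfy Hall's condition, hence the
   representation by down-sets has height at most ch(P), and it cannot be
   shrunk, i.e. modified so as to use fewer symbols without getting higher.

   Second, in a block A which cannot be shrunk: the strict down-sets D(m) of the
   maximal elements m form a chain under inclusion (otherwise the symbols of two
   of them can be merged); if D(p) is the largest one, then only p attains it,
   all other maximal elements have the same strict down-set, and there are at
   most two of them (otherwise a maximal x is recoded by D(x) and two other
   symbols).  Since moreover no element is the join of its strict down-set, this
   leaves antichains, chain + point, and Z.  Conversely these blocks (antichains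
   of size at most 4 below the top) need |A| symbols in every representation,
   and symbol counts add up along a vertical sum. *)

(** * The exchange that bounds the number of symbols by [#|P|] *)

Section Compression.
Context {d : Order.disp_t} {P : finPOrderType d}.
Local Open Scope order_scope.

Definition sumset (U V : finType) (A : {set U}) (B : {set V}) : {set U + V} :=
  inl @: A :|: inr @: B.

Lemma inl_sumset (U V : finType) (A : {set U}) (B : {set V}) u :
  (inl u \in sumset A B) = (u \in A).
Proof.
rewrite inE mem_imset; last by move=> ? ? [].
by case: imsetP => [[]|_]; rewrite ?orbF.
Qed.

Lemma inr_sumset (U V : finType) (A : {set U}) (B : {set V}) v :
  (inr v \in sumset A B) = (v \in B).
Proof.
rewrite inE orbC mem_imset; last by move=> ? ? [].
by case: imsetP => [[]|_]; rewrite ?orbF.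
Qed.

Lemma card_sumset (U V : finType) (A : {set U}) (B : {set V}) :
  (#|sumset A B| <= #|A| + #|B|)%N.
Proof.
by apply: leq_trans (leq_card_setU _ _) _; apply: leq_add; apply: leq_imset_card.
Qed.

(* Take [Y] maximizing |Y| - |N(Y)|, where N(Y) is the union of the S_y, y in
   [Y]; keep the symbols in N(Y) and replace all the others by the down-sets of
   the elements outside [Y].  Comparing [Y] with [Y :|: down-set of x] shows
   that no set grows. *)
Lemma compress (U : finType) (S : P -> {set U}) : inclusion_rep S ->
  exists T : P -> {set U + P},
    [/\ inclusion_rep T, forall x, (#|T x| <= #|S x|)%N &
        forall Z : {set P},
          (#|\bigcup_x T x| + #|Z| <= #|P| + #|\bigcup_(z in Z) S z|)%N].
Proof.
move=> Srep; pose N (Y : {set P}) := \bigcup_(y in Y) S y.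
(* Counting [~: N Z] instead of subtracting [N Z] shifts the quantity by the constant [#|U|] and
   avoids truncated subtraction. *)
have [Y maxY] : exists Y : {set P},
    forall Z : {set P}, (#|Z| + #|~: N Z| <= #|Y| + #|~: N Y|)%N.
  case: (@arg_maxnP _ set0 xpredT (fun Y => #|Y| + #|~: N Y|)%N) => // Y _ h.
  by exists Y => // Z; apply: h.
pose D x := [set z : P | z <= x].
exists (fun x => sumset (S x :&: N Y) (D x :\: Y)); split.
- move=> x y; apply/idP/subsetP => [xy [u|z]|sub].
  + rewrite !inl_sumset !inE => /andP[ux ->]; rewrite andbT.
    by move: xy; rewrite Srep => /subsetP; apply.
  + by rewrite !inr_sumset !inE => /andP[-> /le_trans]; apply.
  have [xY|xY] := boolP (x \in Y); last first.
    by have := sub (inr x); rewrite !inr_sumset !inE xY lexx; apply.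
  rewrite Srep; apply/subsetP => u ux.
  have uN : u \in N Y by apply/bigcupP; exists x.
  by have := sub (inl u); rewrite !inl_sumset !inE ux uN => /(_ isT)/andP[].
- move=> x; apply: leq_trans (card_sumset _ _) _.
  have eN : N (Y :|: D x) = N Y :|: S x.
    apply/setP=> u; rewrite inE; apply/bigcupP/orP.
      case=> y; rewrite !inE => /orP[yY uy|]; first by left; apply/bigcupP; exists y.
      by rewrite Srep => /subsetP sub /sub; right.
    case=> [/bigcupP[y yY uy]|ux]; first by exists y => //; rewrite inE yY.
    by exists x => //; rewrite !inE lexx orbT.
  have := maxY (Y :|: D x); rewrite eN.
  have := cardsUI Y (D x); have := cardsUI (N Y) (S x).
  have := cardsID Y (D x); have := cardsC (N Y); have := cardsC (N Y :|: S x).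
  rewrite [D x :&: Y]setIC [S x :&: N Y]setIC; lia.
(* At most [#|N Y| + (#|P| - #|Y|)] symbols remain, and the maximality of [Y] compares this with
   [Z]. *)
move=> Z; have sub : \bigcup_x sumset (S x :&: N Y) (D x :\: Y)
    \subset sumset (N Y) (~: Y).
  apply/bigcupsP => x _; apply/subsetP => -[u|z].
    by rewrite !inl_sumset inE => /andP[].
  by rewrite !inr_sumset !inE => /andP[].
have wT := leq_trans (subset_leq_card sub) (card_sumset _ _).
apply: leq_trans (leq_add wT (leqnn _)) _.
have := maxY Z; have := cardsC (N Y); have := cardsC (N Z).
have : (#|Y| + #|~: Y| = #|P|)%N := cardsC Y.
rewrite -/(N Z); lia.
Qed.

Lemma cw_min (U : finType) (S : P -> {set U}) : inclusion_rep S ->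
  (forall x, (#|S x| <= ch P)%N) -> (cw P <= #|\bigcup_x S x|)%N.
Proof.
move=> Srep Sch; rewrite /cw; case: ex_minnP => w _; apply.
by apply/asboolP; exists U, S.
Qed.

Lemma cw_attained : exists (U : finType) (S : P -> {set U}),
  [/\ inclusion_rep S, forall x, (#|S x| <= ch P)%N & #|\bigcup_x S x| = cw P].
Proof. by rewrite /cw; case: ex_minnP => w /asboolP. Qed.

Lemma ch_min (U : finType) (S : P -> {set U}) h : inclusion_rep S ->
  (forall x, (#|S x| <= h)%N) -> (ch P <= h)%N.
Proof.
move=> Srep Sh; rewrite /ch; case: ex_minnP => k _; apply.
by apply/asboolP; exists U, S.
Qed.

Lemma cw_le_card : (cw P <= #|P|)%N.
Proof.
have [U [S [/compress[T [Trep TS /(_ set0) wT]] Sch _]]] := cw_attained.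
apply: leq_trans (cw_min Trep _) _ => [x|]; first exact: leq_trans (Sch x).
by move: wT; rewrite big_set0 !cards0 !addn0.
Qed.

(** When [cw P = #|P|], compression leaves no slack, so every [Z] carries at least [#|Z|] symbols.
    For the down-set of [x] all these symbols lie in [S x]. *)
Lemma downset_le_ch (x : P) :
  cw P = #|P| -> (#|[set z : P | (z <= x)%O]| <= ch P)%N.
Proof.
move=> cwP; have [U [S [Srep Sch _]]] := cw_attained.
have [T [Trep TS wT]] := compress Srep.
have wP := cw_min Trep (fun x => leq_trans (TS x) (Sch x)).
have := leq_trans (leq_add wP (leqnn _)) (wT [set z | z <= x]).
rewrite cwP leq_add2l => /leq_trans; apply; apply: leq_trans (Sch x).
by apply/subset_leq_card/bigcupsP => z; rewrite inE Srep.
Qed.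

End Compression.

(** * Representations of a subposet with one symbol fewer *)

Section Shrinking.
Context {d : Order.disp_t} {P : finPOrderType d}.
Implicit Types (A L : {set P}) (w x y z p q : P) (E : P -> {set P}).
Local Open Scope order_scope.

Definition subrep A (U : finType) (S : P -> {set U}) : Prop :=
  {in A &, forall x y, (x <= y) = (S x \subset S y)}.

Definition dn A x := [set z in A | z <= x].
Definition sdn A x := [set z in A | z < x].

(* The symbols are elements of [P], so that a representation of a block can be
   combined with the down-sets of the elements outside it. *)
Definition shrinkable A : Prop :=
  exists w (S : P -> {set P}),
    [/\ w \in A, {in A, forall x, S x \subset A :\ w}, subrep A S &
        {in A, forall x, exists2 y, y \in A & (#|S x| <= #|dn A y|)%N}].

(** Not a vertical sum of two non-empty parts, phrased so that a candidate lower part [L] is forced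
    to be all of [A]. *)
Definition irreducible A : Prop :=
  forall L, L \subset A -> L != set0 ->
    (forall x y, x \in L -> y \in A -> y \notin L -> x < y) -> L = A.

Definition maxel A x := (x \in A) && [forall y in A, ~~ (x < y)].

Lemma maxelP A x y : maxel A x -> y \in A -> (x <= y) = (x == y).
Proof.
case/andP=> xA /forall_inP maxx yA; rewrite le_eqVlt.
by rewrite (negPf (maxx _ yA)) orbF.
Qed.

Lemma maxel_sdn A x y : maxel A x -> y \in A -> (x \in sdn A y) = false.
Proof.
case/andP=> xA /forall_inP maxx yA.
by rewrite inE xA (negPf (maxx _ yA)).
Qed.

Lemma dn_sdn A x : x \in A -> dn A x = x |: sdn A x.
Proof.
move=> xA; apply/setP=> z; rewrite !inE le_eqVlt andb_orr.
by case: eqP => [->|_]; rewrite ?xA ?andbF.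
Qed.

Lemma card_dn A x : x \in A -> #|dn A x| = #|sdn A x|.+1.
Proof. by move=> xA; rewrite dn_sdn // cardsU1 inE ltxx andbF. Qed.

Lemma maxel_above A x : x \in A -> exists2 m, maxel A m & x <= m.
Proof.
move=> xA; pose up := [pred m | (m \in A) && (x <= m)].
have [|m /andP[mA xm] maxm] := @arg_maxnP _ x up (fun m => #|dn A m|).
  by rewrite /= xA lexx.
exists m => //; rewrite /maxel mA; apply/forall_inP => y yA; apply/negP => my.
have := maxm y; rewrite /= yA (le_trans xm (ltW my)) => /(_ isT).
apply/negP; rewrite -ltnNge; apply/proper_card/properP; split.
  apply/subsetP => z; rewrite !inE => /andP[-> /le_trans]; apply; exact: ltW.
by exists y; rewrite !inE yA ?lexx //= lt_geF.
Qed.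

(** By hypothesis [x] is the join in [A] of its strict down-set, so the symbol [x] is redundant and
    can be deleted from every down-set. *)
Lemma shrink_join A x : x \in A ->
  {in A, forall y, sdn A x \subset dn A y -> x <= y} -> shrinkable A.
Proof.
move=> xA xjoin; exists x, (fun y => dn A y :\ x); split=> //.
- move=> y yA; apply/subsetP => z; rewrite !inE => /and3P[-> ->] //.
- move=> y z yA zA; apply/idP/subsetP => [yz t|sub].
    by rewrite !inE => /and3P[-> -> /le_trans]; apply.
  have [yx|yx] := eqVneq y x; last first.
    by have := sub y; rewrite !inE yA yx lexx => /(_ isT) /andP[].
  rewrite yx; apply: xjoin => //; apply/subsetP => t.
  rewrite !inE => /andP[tA tx]; rewrite tA.
  by have := sub t; rewrite !inE tA lt_eqF // yx ltW // => /(_ isT).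
by move=> y yA; exists y => //; apply/subset_leq_card/subsetDl.
Qed.

(* The symbol of a non-maximal element is kept; that of a maximal element [x]
   is replaced by the set of symbols [E x]. *)
Lemma shrink_top A w E : maxel A w ->
  {in A, forall x, E x \subset A :\ w} ->
  {in A, forall x, ~~ maxel A x -> E x = [set x]} ->
  {in A &, forall x y, x != y -> sdn A x \subset sdn A y :|: E y ->
     E x \subset sdn A y :|: E y -> x < y} ->
  {in A, forall x, exists2 y, y \in A & (#|sdn A x| + #|E x| <= #|dn A y|)%N} ->
  shrinkable A.
Proof.
move=> mw EA E1 Esep Eh; have /andP[wA /forall_inP maxw] := mw.
exists w, (fun x => sdn A x :|: E x); split=> //.
- move=> x xA; rewrite subUset EA // andbT; apply/subsetP => z.
  rewrite !inE => /andP[zA zx]; rewrite zA andbT; apply/eqP => zw.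
  by have := maxw x xA; rewrite -zw zx.
- move=> x y xA yA; have [->|xy] := eqVneq x y; first by rewrite lexx subxx.
  rewrite le_eqVlt (negPf xy) /=; apply/idP/idP => [ltxy|]; last first.
    by rewrite subUset => /andP[]; apply: Esep.
  rewrite E1 //; last by apply/negP => /maxelP/(_ yA); rewrite ltW // (negPf xy).
  apply/subsetP => z; rewrite !inE => /orP[/andP[-> /lt_trans->//]|/eqP->].
  by rewrite xA ltxy.
move=> x xA; have [y yA hy] := Eh x xA; exists y => //.
exact: leq_trans (leq_card_setU _ _) hy.
Qed.

End Shrinking.

(** * Recodings of maximal elements that save a symbol *)

Section ShrinkingMoves.
Context {d : Order.disp_t} {P : finPOrderType d}.
Implicit Types (A L X : {set P}) (x y z p q : P).
Local Open Scope order_scope.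

Lemma sdn_strip A x y X : x \in A -> {in X, forall m, maxel A m} ->
  sdn A x \subset sdn A y :|: X -> sdn A x \subset sdn A y.
Proof.
move=> xA maxX /subsetP sub; apply/subsetP => z zx.
have := sub z zx; rewrite in_setU => /orP[//|/maxX mz].
by rewrite maxel_sdn in zx.
Qed.

(** Both maximal elements use the symbol [y]; their strict down-sets alone keep them
    incomparable. *)
Lemma shrink_merge A x y : maxel A x -> maxel A y -> x != y ->
  ~~ (sdn A x \subset sdn A y) -> ~~ (sdn A y \subset sdn A x) -> shrinkable A.
Proof.
move=> mx my xy nxy nyx; have /andP[xA _] := mx; have /andP[yA _] := my.
apply: (@shrink_top _ _ A x (fun z => [set if z == x then y else z])) => //.
- move=> z zA; rewrite sub1set !inE.
  by case: (eqVneq z x) => [_|zx]; rewrite ?yA ?zA ?zx // eq_sym xy.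
- by move=> z zA; case: eqVneq => // ->; rewrite mx.
- move=> a b aA bA ab; rewrite sub1set inE in_set1.
  have [ax|ax] := eqVneq a x.
    rewrite maxel_sdn //= => sub; have [bx|bx] := eqVneq b x.
      by move: ab; rewrite ax bx eqxx.
    rewrite (negPf bx) in sub *; move/eqP=> yb; case/negP: nxy; rewrite -ax yb.
    by apply: (sdn_strip aA _ sub) => m /set1P->; rewrite -yb.
  have [bx|bx] := eqVneq b x; last first.
    by rewrite (negPf ab) orbF inE => _ /andP[].
  move=> sub /orP[|/eqP ay]; first by rewrite inE => /andP[].
  case/negP: nyx; rewrite -ay -bx.
  by apply: (sdn_strip aA _ sub) => m /set1P->.
by move=> z zA; exists z => //; rewrite cards1 card_dn // addn1.
Qed.

(** The symbol [x] is replaced by the pair [p], [q]. No other set contains both, and the strict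
    down-sets of [p] and [q] keep these two from falling below [x]. The element [y] supplies the
    height for the extra symbol. *)
Lemma shrink_pair A x p q y : maxel A x -> maxel A p -> maxel A q ->
  uniq [:: x; p; q] -> ~~ (sdn A p \subset sdn A x) ->
  ~~ (sdn A q \subset sdn A x) ->
  y \in A -> (#|sdn A x| + 2 <= #|dn A y|)%N -> shrinkable A.
Proof.
move=> mx mp mq; rewrite /= !inE negb_or andbT => /andP[/andP[xp xq] pq].
move=> npx nqx yA hy; have /andP[xA _] := mx.
have /andP[pA _] := mp; have /andP[qA _] := mq.
apply: (@shrink_top _ _ A x
  (fun z => if z == x then [set p; q] else [set z])) => //.
- move=> z zA; case: eqVneq => [_|zx]; last by rewrite sub1set !inE zx.
  by rewrite subUset !sub1set !inE ![_ == x]eq_sym xp xq pA.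
- by move=> z zA; case: eqVneq => // ->; rewrite mx.
- move=> a b aA bA ab sub; have [ax|ax] := eqVneq a x.
    have bx : b != x by rewrite -ax eq_sym.
    rewrite (negPf bx) subUset !sub1set !inE.
    move: (maxel_sdn mp bA) (maxel_sdn mq bA); rewrite !inE => -> -> /=.
    by case/andP=> /eqP pb /eqP qb; rewrite pb qb eqxx in pq.
  rewrite sub1set in_setU => /orP[|]; first by rewrite inE => /andP[].
  move: sub; case: eqVneq => [->|_]; last by rewrite inE (negPf ab).
  move=> sub; have {}sub : sdn A a \subset sdn A x.
    by apply: (sdn_strip aA _ sub) => m /set2P[->|->].
  by case/set2P=> e; move: npx nqx; rewrite -e sub.
move=> z zA; have [->|_] := eqVneq z x.
  by exists y => //; rewrite cards2 pq.
by exists z => //; rewrite cards1 card_dn // addn1.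
Qed.

(** The three elements with a common strict down-set receive the three pairs from [y], [z], [p],
    which saves the symbol [x]. The larger strict down-set of [p] separates [p] from them and
    supplies the height. *)
Lemma shrink_triple A x y z p : maxel A x -> maxel A y -> maxel A z ->
  maxel A p -> uniq [:: x; y; z; p] ->
  sdn A y = sdn A x -> sdn A z = sdn A x -> sdn A x \proper sdn A p ->
  shrinkable A.
Proof.
move=> mx my mz mp; rewrite /= !inE !negb_or andbT.
case/and3P=> /and3P[xy xz xp] /andP[yz yp] zp sy sz.
move=> /[dup] /proper_card lt /properP[_ [t tp tx]].
have /andP[xA _] := mx; have /andP[yA _] := my.
have /andP[zA _] := mz; have /andP[pA _] := mp.
pose E (u : P) := if u == x then [set y; z] else if u == y then [set y; p]
  else if u == z then [set z; p] else [set u].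
have Ex : E x = [set y; z] by rewrite /E eqxx.
have Ey : E y = [set y; p] by rewrite /E eq_sym (negPf xy) eqxx.
have Ez : E z = [set z; p].
  by rewrite /E eq_sym (negPf xz) eq_sym (negPf yz) eqxx.
have En u : u != x -> u != y -> u != z -> E u = [set u].
  by rewrite /E => /negPf-> /negPf-> /negPf->.
apply: (@shrink_top _ _ A x E) => //.
- move=> u uA; have [->|ux] := eqVneq u x.
    by rewrite Ex subUset !sub1set !inE ![_ == x]eq_sym xy xz yA.
  have [->|uy] := eqVneq u y.
    by rewrite Ey subUset !sub1set !inE ![_ == x]eq_sym xy xp yA.
  have [->|uz] := eqVneq u z.
    by rewrite Ez subUset !sub1set !inE ![_ == x]eq_sym xz xp zA.
  by rewrite En // sub1set !inE ux.
- move=> u uA nu; apply: En; apply: contraNneq nu => -> //.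
- move=> a b aA bA ab sub sEa.
  (* The symbol of a maximal element occurs in no strict down-set, so it can only be matched inside
     [E b]. *)
  have mE m : maxel A m -> m \in E a -> m \in E b.
    by move=> mm /(subsetP sEa); rewrite in_setU maxel_sdn.
  have Eb : [\/ b = x /\ E b = [set y; z], b = y /\ E b = [set y; p],
             b = z /\ E b = [set z; p] | E b = [set b]].
    have [->|bx] := eqVneq b x; first by constructor 1.
    have [->|by_] := eqVneq b y; first by constructor 2.
    have [->|bz] := eqVneq b z; first by constructor 3.
    by constructor 4; rewrite En.
  move/eqP: xy => xy; move/eqP: xz => xz; move/eqP: xp => xp.
  move/eqP: yz => yz; move/eqP: yp => yp; move/eqP: zp => zp.
  have [ax|/[dup]/eqP ax ax'] := eqVneq a x.
    have := mE z mz; have := mE y my; rewrite {1 2}ax Ex set22 set21.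
    move/eqP: ab; case: Eb => [[bE ->]|[bE ->]|[bE ->]|->] ab /(_ isT) + /(_ isT).
    - congruence.
    - by move=> _ /set2P[]; congruence.
    - by move=> /set2P[]; congruence.
    - by move=> /set1P + /set1P; congruence.
  have [ay|/[dup]/eqP ay ay'] := eqVneq a y.
    have := mE p mp; have := mE y my; rewrite {1 2}ay Ey set22 set21.
    move/eqP: ab; case: Eb => [[bE ->]|[bE ->]|[bE ->]|->] ab /(_ isT) + /(_ isT).
    - by move=> _ /set2P[]; congruence.
    - congruence.
    - by move=> /set2P[]; congruence.
    - by move=> /set1P + /set1P; congruence.
  have [az|/[dup]/eqP az az'] := eqVneq a z.
    have := mE p mp; have := mE z mz; rewrite {1 2}az Ez set22 set21.
    move/eqP: ab; case: Eb => [[bE ->]|[bE ->]|[bE ->]|->] ab /(_ isT) + /(_ isT).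
    - by move=> _ /set2P[]; congruence.
    - by move=> /set2P[]; congruence.
    - congruence.
    - by move=> /set1P + /set1P; congruence.
  move: sEa; rewrite En // sub1set in_setU => /orP[|]; first by rewrite inE => /andP[].
  (* [p] cannot fall below a recoded element: [t] is in its strict down-set but not in theirs. *)
  have nps X : {in X, forall m, maxel A m} -> sdn A b = sdn A x -> a = p ->
      E b = X -> a < b.
    move=> maxX sb ap Xb; rewrite ap Xb in sub.
    have /subsetP/(_ t tp) := sdn_strip pA maxX sub.
    by rewrite sb (negPf tx).
  case: Eb => [[bE eE]|[bE eE]|[bE eE]|eE]; rewrite eE.
  - by move=> /set2P[]; congruence.
  - case/set2P => [//|ap]; apply: nps ap eE; last by rewrite bE.
    by move=> m /set2P[]->.
  - case/set2P => [//|ap]; apply: nps ap eE; last by rewrite bE.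
    by move=> m /set2P[]->.
  - by rewrite inE (negPf ab).
move=> u uA; have [->|ux] := eqVneq u x.
  by exists p => //; rewrite Ex cards2 yz card_dn // addn2 ltnS.
have [->|uy] := eqVneq u y.
  by exists p => //; rewrite Ey cards2 yp card_dn // addn2 sy ltnS.
have [->|uz] := eqVneq u z.
  by exists p => //; rewrite Ez cards2 zp card_dn // addn2 sz ltnS.
by exists u => //; rewrite En // cards1 card_dn // addn1.
Qed.

(** On top of their common strict down-set, [x] receives [y], [p] and [y] receives [y], [q]. In the
    chain [a < q < p], the element [q] keeps [p] from falling below [x], and [a] keeps [q] from
    falling below [y]. *)
Lemma shrink_two A x y p q a : maxel A x -> maxel A y -> maxel A p ->
  uniq [:: x; y; p] -> sdn A y = sdn A x -> sdn A x \subset sdn A p ->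
  q \in sdn A p -> q \notin sdn A x -> a \in sdn A q -> a \notin sdn A x ->
  shrinkable A.
Proof.
move=> mx my mp unq sy sub qp qx aq ax.
move: unq; rewrite /= !inE !negb_or andbT => /andP[/andP[xy xp] yp].
have /andP[xA _] := mx; have /andP[yA _] := my; have /andP[pA _] := mp.
have /andP[qA qltp] : (q \in A) && (q < p) by move: qp; rewrite inE.
have /andP[aA altq] : (a \in A) && (a < q) by move: aq; rewrite inE.
have nmq u : maxel A u -> u != q by apply: contraTneq => ->; apply: contraTN qp => /maxel_sdn->.
have nma u : maxel A u -> u != a by apply: contraTneq => ->; apply: contraTN aq => /maxel_sdn->.
have lt : (#|sdn A x| < #|sdn A p|)%N.
  by apply/proper_card/properP; split=> //; exists q.
pose E (u : P) := if u == x then [set y; p] else if u == y then [set y; q]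
  else [set u].
have Ex : E x = [set y; p] by rewrite /E eqxx.
have Ey : E y = [set y; q] by rewrite /E eq_sym (negPf xy) eqxx.
have En u : u != x -> u != y -> E u = [set u].
  by rewrite /E => /negPf-> /negPf->.
apply: (@shrink_top _ _ A x E) => //.
- move=> u uA; have [->|ux] := eqVneq u x.
    by rewrite Ex subUset !sub1set !inE ![_ == x]eq_sym xy xp yA.
  have [->|uy] := eqVneq u y.
    by rewrite Ey subUset !sub1set !inE ![_ == x]eq_sym xy nmq // yA.
  by rewrite En // sub1set !inE ux.
- by move=> u uA nu; apply: En; apply: contraNneq nu => ->.
- move=> u v uA vA uv su sEu.
  have mE m : maxel A m -> m \in E u -> m \in E v.
    by move=> mm /(subsetP sEu); rewrite in_setU maxel_sdn.
  have [eu|ux] := eqVneq u x.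
    have := mE p mp; have := mE y my; rewrite {1 2}eu Ex set22 set21.
    have [->|vy] := eqVneq v y.
      rewrite Ey => _ /(_ isT); rewrite !inE (negPf (nmq _ mp)).
      by rewrite eq_sym (negPf yp).
    rewrite En //; last by rewrite -eu eq_sym.
    by rewrite !inE => /(_ isT)/eqP<- /(_ isT)/eqP py; rewrite py eqxx in yp.
  have [eu|uy] := eqVneq u y.
    have := mE y my; rewrite {1}eu Ey set21 => /(_ isT).
    have [ev|vx] := eqVneq v x.
      move: sEu; rewrite eu ev Ex Ey => /subsetP/(_ q (set22 _ _)).
      rewrite in_setU (negPf qx) !in_set2 ![q == _]eq_sym.
      by rewrite (negPf (nmq _ my)) (negPf (nmq _ mp)).
    by rewrite En // -?eu 1?eq_sym // inE (negPf uv).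
  move: sEu; rewrite En // sub1set in_setU => /orP[|].
    by rewrite inE => /andP[].
  have [ev|vx] := eqVneq v x.
    rewrite ev Ex => /set2P[/eqP|up]; first by rewrite (negPf uy).
    move: su; rewrite up ev Ex => /subsetP/(_ q qp); rewrite in_setU (negPf qx).
    by rewrite in_set2 ![q == _]eq_sym (negPf (nmq _ my)) (negPf (nmq _ mp)).
  have [ev|vy] := eqVneq v y; last by rewrite En // inE (negPf uv).
  rewrite ev Ey => /set2P[/eqP|uq]; first by rewrite (negPf uy).
  move: su; rewrite uq ev Ey => /subsetP/(_ a aq).
  rewrite in_setU sy (negPf ax) in_set2 eq_sym (negPf (nma _ my)) /=.
  by rewrite lt_eqF.
move=> u uA; have [->|ux] := eqVneq u x.
  by exists p => //; rewrite Ex cards2 yp card_dn // addn2 ltnS.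
have [->|uy] := eqVneq u y.
  by exists p => //; rewrite Ey cards2 nmq // card_dn // addn2 sy ltnS.
by exists u => //; rewrite En // cards1 card_dn // addn1.
Qed.

End ShrinkingMoves.

(** * Irreducible posets that cannot be shrunk *)

Section IrreducibleClasses.
Context {d : Order.disp_t} {P : finPOrderType d}.
Implicit Types (A L X : {set P}) (x y z p q : P).
Local Open Scope order_scope.

Definition Zshape A : Prop := exists a b c e : P,
  [/\ A = [set a; b; c; e], uniq [:: a; b; c; e], a < b, (a >< c) && (b >< c) &
      [&& a >< e, b >< e & c >< e]].

Lemma not_join A z : ~ shrinkable A -> z \in A ->
  exists y, [/\ y \in A, sdn A z \subset dn A y & ~~ (z <= y)].
Proof.
move=> nsh zA; apply: contrapT => nex; apply/nsh/(shrink_join zA) => y yA sub.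
by apply: contraT => nzy; case: nex; exists y.
Qed.

(** With [L = sdn A x] and [D = dn A p], a suitable lowest element [c] of [D] outside [L] has its
    strict down-set inside [L]. Then [L] lies below everything else, so irreducibility makes it
    empty, and [D] is a chain with bottom [c], incomparable with [x]. *)
Lemma irreducible_chain A x p : irreducible A -> ~ shrinkable A ->
  maxel A x -> maxel A p -> x != p -> sdn A p != set0 ->
  sdn A x \proper sdn A p ->
  {in A, forall z, [|| z \in sdn A p, z == p | z == x]} -> in_B A.
Proof.
move=> irrA nsh mx mp xp I0 /properP[sub [i0 i0I i0L]] AE.
have /andP[xA _] := mx; have /andP[pA _] := mp.
set L := sdn A x in sub i0L *; set D := dn A p.
have DE : D = p |: sdn A p by apply: dn_sdn.
have pL : p \notin L by rewrite maxel_sdn.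
have ADx z : z \in A -> z \in D \/ z = x.
  move=> /AE /or3P[zI|/eqP->|/eqP->]; last by right.
    by left; rewrite DE in_setU zI orbT.
  by left; rewrite DE setU11.
pose K (c : P) := [&& c \in D, c \notin L &
  [forall (e | e \in D), (c <= e) ==> [forall (f | f \in D), e >=< f]]].
have Kp : K p.
  rewrite /K pL DE setU11 -DE /=; apply/forall_inP => e eD; apply/implyP => pe.
  apply/forall_inP => f; rewrite inE => /andP[_ fp].
  by rewrite comparable_sym le_comparable // (le_trans fp pe).
have [c /and3P[cD cL /forall_inP Kc] minc] :=
  @arg_minnP _ p K (fun c => #|sdn A c|) Kp.
have cA : c \in A by move: cD; rewrite inE => /andP[].
have cmp f : f \in D -> c >=< f.
  by move=> fD; have /implyP/(_ (lexx c))/forall_inP := Kc c cD; apply.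
(* Since [c] is not a join, some [y] bounds [sdn A c] without being above [c]. In [D] but outside
   [L], such a [y] would be a lower candidate; in the other cases [sdn A c] is inside [L]. *)
have scL : sdn A c \subset L.
  have [y [yA sub_y ncy]] := not_join nsh cA.
  have [yD|yx] := ADx y yA; last first.
    apply/subsetP => z zc; have := subsetP sub_y z zc; rewrite yx.
    rewrite dn_sdn // in_setU1 => /orP[/eqP zx|//].
    by move: zc; rewrite zx maxel_sdn.
  have yltc : y < c.
    by have := cmp y yD; case: (comparableP c y) ncy.
  have [yL|yL] := boolP (y \in L).
    apply: subset_trans sub_y _; apply/subsetP => z; move: yL; rewrite !inE.
    by case/andP=> _ yx /andP[-> /le_lt_trans]; apply.
  have le_y f : f \in D -> f < c -> f <= y.
    rewrite inE => /andP[fA _] fc.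
    by have := subsetP sub_y f; rewrite !inE fA fc => /(_ isT)/andP[].
  have /minc : K y.
    rewrite /K yD yL; apply/forall_inP => e eD; apply/implyP => ye.
    apply/forall_inP => f fD; move: (cmp e eD).
    rewrite /Order.comparable => /orP[ce|ec].
      by have /implyP/(_ ce)/forall_inP := Kc e eD; apply.
    have [-> | ltec] := eqVneq e c; first exact: cmp.
    have /eqP <- : y == e by rewrite eq_le ye le_y // lt_neqAle ltec.
    move: (cmp f fD); rewrite /Order.comparable => /orP[cf|fc].
      by rewrite (le_trans (ltW yltc) cf).
    have [-> | ltfc] := eqVneq f c; first by rewrite ltW.
    by rewrite le_y ?orbT // lt_neqAle ltfc.
  rewrite leqNgt => /negP[]; apply/proper_card/properP; split.
    by apply/subsetP => z; rewrite !inE => /andP[-> /lt_trans]; apply.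
  by exists y; rewrite !inE yA ?ltxx.
have c_le e : e \in D -> e \notin L -> c <= e.
  move=> eD eL; have := cmp e eD; rewrite /Order.comparable.
  case/orP => // ec; have [->//|ltec] := eqVneq e c.
  have := subsetP scL e; rewrite (negPf eL) inE lt_neqAle ltec ec andbT.
  by move: eD; rewrite inE => /andP[-> _] /(_ isT).
have L0 : L = set0.
  apply/eqP; apply: contraT => nL0; have LA : L = A.
    apply: irrA => //; first by apply/subsetP => z; rewrite inE => /andP[].
    move=> l r lL rA rL; have [rD|->] := ADx r rA; last first.
      by move: lL; rewrite inE => /andP[].
    apply: lt_le_trans (c_le r rD rL); rewrite lt_neqAle.
    have lD : l \in D by rewrite DE in_setU (subsetP sub) ?orbT.
    rewrite (contraNneq _ cL) => [|<-//] /=.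
    have := cmp l lD; rewrite /Order.comparable => /orP[cl|//].
    case/negP: cL; move: lL; rewrite !inE cA => /andP[_ lx].
    exact: le_lt_trans lx.
  by rewrite LA pA in pL.
exists D, x; split.
- apply/setP=> z; rewrite in_setU1; apply/idP/orP.
    by move/ADx => []; [right|left; apply/eqP].
  by case=> [/eqP->//|]; rewrite inE => /andP[].
- move=> a b aD bD; have /implyP/(_ (c_le a aD _))/forall_inP := Kc a aD.
  by apply=> //; rewrite L0 inE.
- by rewrite card_dn // ltnS card_gt0.
- by rewrite inE xA (maxelP mx).
move=> e eD; apply/negP; rewrite /Order.comparable => /orP[ex|xe].
  have : e \in L.
    rewrite inE lt_neqAle ex andbT; move: (eD); rewrite inE => /andP[-> _] /=.
    by apply: contraTneq eD => ->; rewrite inE (maxelP mx) // (negPf xp) andbF.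
  by rewrite L0 inE.
move: (eD); rewrite inE => /andP[eA _]; move: xe; rewrite (maxelP mx) // => /eqP xe.
by move: eD; rewrite -xe inE (maxelP mx) // (negPf xp) andbF.
Qed.

(** As [p] is not a join, its strict down-set has a greatest element [q], which is not below [x]. By
    [shrink_two] only [q] lies in [sdn A p] outside [sdn A x]; the latter is then below everything
    else, hence empty by irreducibility. *)
Lemma irreducible_Z A x y p : irreducible A -> ~ shrinkable A ->
  maxel A x -> maxel A y -> maxel A p -> uniq [:: x; y; p] ->
  sdn A y = sdn A x -> sdn A x \proper sdn A p ->
  {in A, forall z, [|| z \in sdn A p, z == p, z == x | z == y]} -> Zshape A.
Proof.
move=> irrA nsh mx my mp unq sy /[dup] Lprop /properP[sub [i0 i0I i0L]] AE.
have /andP[xA _] := mx; have /andP[yA _] := my; have /andP[pA _] := mp.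
have [q [qA subq npq]] := not_join nsh pA.
have nIL z : sdn A p \subset sdn A z -> sdn A z \subset sdn A x -> False.
  move=> s1 s2; move: i0L; rewrite (subsetP s2) //; exact: subsetP s1 _ i0I.
have qI : q \in sdn A p.
  have mq_False : maxel A q -> sdn A q \subset sdn A x -> False.
    move=> mq; apply: nIL; apply: (@sdn_strip _ _ _ _ _ [set q]) => //.
      by move=> m /set1P->.
    by rewrite setUC -dn_sdn.
  have /or4P[//|/eqP qp|/eqP qx|/eqP qy] := AE q qA.
  - by rewrite qp lexx in npq.
  - by case: mq_False; rewrite qx.
  - by case: mq_False; rewrite qy // sy.
have qL : q \notin sdn A x.
  apply: contraNN i0L => qL; move: (subsetP subq _ i0I) qL; rewrite !inE.
  by move=> /andP[-> /le_lt_trans lt] /andP[_ /lt]->.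
have onlyq a : a \in sdn A p -> a \notin sdn A x -> a = q.
  move=> aI aL; apply/eqP; apply: contraT => aq; case: nsh.
  apply: (shrink_two mx my mp unq sy sub qI qL _ aL).
  have := subsetP subq a aI; rewrite !inE => /andP[-> aleq].
  by rewrite lt_neqAle aq.
have L0 : sdn A x = set0.
  apply/eqP; apply: contraT => nL0; have LA : sdn A x = A.
    apply: irrA => //; first by apply/subsetP => z; rewrite inE => /andP[].
    move=> l r lL rA rL; have /or4P[rI|/eqP->|/eqP->|/eqP->] := AE r rA.
    - rewrite (onlyq r rI rL) lt_neqAle; apply/andP; split.
        by apply: contraNneq qL => <-.
      by have := subsetP subq l (subsetP sub l lL); rewrite inE => /andP[].
    - by have := subsetP sub l lL; rewrite inE => /andP[].
    - by move: lL; rewrite inE => /andP[].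
    - by move: lL; rewrite -sy inE => /andP[].
  by move: qL; rewrite LA qA.
have qp : q < p by move: qI; rewrite inE => /andP[].
have inc z m : maxel A m -> sdn A m = set0 -> z \in A -> z != m -> z >< m.
  move=> mm m0 zA zm; apply/negP; rewrite /Order.comparable (maxelP mm) //.
  rewrite [m == z]eq_sym (negPf zm) orbF => zlem.
  have : z \in sdn A m by rewrite inE zA lt_neqAle zm.
  by rewrite m0 inE.
move: unq; rewrite /= !inE !negb_or andbT => /andP[/andP[xy xp] yp].
have nq m : maxel A m -> q != m.
  by apply: contraTneq => <-; apply: contraTN qI => /maxel_sdn->.
exists q, p, x, y; split=> //.
- apply/setP=> z; rewrite !inE; apply/idP/idP; last first.
    by move=> /orP[/orP[/orP[]|]|] /eqP->.
  move=> zA; have := AE z zA; rewrite -!orbA; case/or4P=> [zI|->|->|->];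
    rewrite ?orbT //.
  by rewrite (onlyq z zI) ?eqxx // L0 inE.
- by rewrite /= !inE !negb_or !nq // ![p == _]eq_sym xp yp xy.
- by rewrite !inc ?nq // eq_sym.
- by rewrite !inc ?sy ?nq // eq_sym.
Qed.

Lemma irreducible_classes A : irreducible A -> (1 < #|A|)%N ->
  ~ shrinkable A -> [\/ in_A A, in_B A | Zshape A].
Proof.
move=> irrA A2 nsh.
have [z0 z0A] : exists z, z \in A by apply/card_gt0P/ltnW.
have [m0 mm0 _] := maxel_above z0A.
have [p mp maxp] := @arg_maxnP _ m0 (maxel A) (fun m => #|sdn A m|) mm0.
have /andP[pA _] := mp.
set I := sdn A p.
(* [shrink_merge] makes the strict down-sets of maximal elements comparable, so the one of largest
   size contains all others. *)
have subI m : maxel A m -> sdn A m \subset I.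
  move=> mm; have [->//|mp'] := eqVneq m p; apply: contraT => nsub.
  have [sub|nsub'] := boolP (I \subset sdn A m).
    have : I == sdn A m by rewrite eqEcard sub; apply: maxp.
    by move/eqP=> e; rewrite e subxx in nsub.
  by case: nsh; apply: shrink_merge nsub nsub'.
have AI z : z \in A -> z \in I \/ maxel A z.
  move=> zA; have [m mm] := maxel_above zA.
  rewrite le_eqVlt => /orP[/eqP->|zm]; first by right.
  by left; apply: (subsetP (subI m mm)); rewrite inE zA.
have [I0|[i iI]] := set_0Vmem I.
  constructor 1; split=> // x y xA yA xy.
  have [|mx] := AI x xA; first by rewrite I0 inE.
  by move: xy; rewrite (maxelP mx) // => /eqP.
have nI0 : I != set0 by apply/set0Pn; exists i.
(* Otherwise [I], which misses [p], would be a proper lower summand. *)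
have [x mx nIx] : exists2 x, maxel A x & ~~ (I \subset sdn A x).
  apply: contrapT => nex; have IA : I = A.
    apply: irrA => //; first by apply/subsetP => z; rewrite inE => /andP[].
    move=> l r lI rA rI; have [rI'|mr] := AI r rA; first by rewrite rI' in rI.
    have [sub|nsub] := boolP (I \subset sdn A r); last by case: nex; exists r.
    by have := subsetP sub l lI; rewrite inE => /andP[].
  by have := maxel_sdn mp pA; rewrite -/I IA pA.
have xp : x != p by apply: contraNneq nIx => ->.
have room m : maxel A m -> ~~ (I \subset sdn A m) ->
    (#|sdn A m| + 2 <= #|dn A p|)%N.
  move=> mm nIm; rewrite card_dn // addn2 ltnS; apply: proper_card.
  by rewrite properE subI.
(* A second maximal element [m] above all of [I] would let [x] be recoded by [p] and [m]. *)
have nI m : maxel A m -> m != p -> ~~ (I \subset sdn A m).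
  move=> mm mp'; apply/negP => Im; apply/nsh.
  apply: (@shrink_pair _ _ A x p m p) => //; last exact: room.
    rewrite /= !inE negb_or xp [p == m]eq_sym mp' !andbT /=.
    by apply: contraNneq nIx => ->.
  by apply: contraNN nIx; apply: subset_trans.
(* Otherwise [a] could be recoded by [b] and [p]. *)
have sdn_sub a b : maxel A a -> maxel A b -> a != p -> b != p -> a != b ->
    sdn A b \subset sdn A a.
  move=> ma mb ap bp ab; apply: contraT => nba; case: nsh.
  apply: (@shrink_pair _ _ A a b p p) => //; last by apply: room => //; apply: nI.
    by rewrite /= !inE negb_or ab ap bp.
  exact: nI.
have same a b : maxel A a -> maxel A b -> a != p -> b != p -> sdn A b = sdn A a.
  move=> ma mb ap bp; have [->//|ab] := eqVneq a b.
  by apply/eqP; rewrite eqEsubset !sdn_sub // eq_sym.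
have Lprop : sdn A x \proper I by rewrite properE subI // nI.
have [[y [my yp yx]]|none] := pselect (exists y, [/\ maxel A y, y != p & y != x]).
  constructor 3; apply: (@irreducible_Z A x y p) => //.
  - by rewrite /= !inE negb_or [x == y]eq_sym yx xp yp.
  - exact: same.
  move=> z zA; have [->//|mz] := AI z zA; apply: contraT.
  rewrite !negb_or => /and4P[_ zp zx zy]; case: nsh.
  apply: (@shrink_triple _ _ A x y z p) => //; try exact: same.
  by rewrite /= !inE !negb_or [x == y]eq_sym [x == z]eq_sym [y == z]eq_sym
     yx zx zy xp yp zp.
constructor 2; apply: (@irreducible_chain A x p) => //.
move=> z zA; have [->//|mz] := AI z zA; apply: contraT.
by rewrite !negb_or => /and3P[_ zp zx]; case: none; exists z.
Qed.

End IrreducibleClasses.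

(** * The poset [Z] through its connected components *)

Section ThreeComponents.
Context {d : Order.disp_t} {P : finPOrderType d}.
Implicit Types A : {set P}.
Local Open Scope order_scope.

(** With four elements and three component representatives there is one non-representative [b]. It
    is comparable with its representative [a], since otherwise it would be isolated and represent
    itself; the other two elements are isolated. *)
Lemma in_ZP A : in_Z A <-> Zshape A.
Proof.
rewrite /in_Z /num_components; set e := [rel x y | _].
have csym : connect_sym e.
  apply: sym_connect_sym => x y /=.
  by rewrite comparable_sym; case: (x \in A); case: (y \in A).
have clA : closed e (mem A).
  by apply: (intro_closed csym) => x y /= /and3P[].
have rootA z : z \in A -> root e z \in A.
  by move=> zA; rewrite -(closed_connect clA (connect_root e z)).
have same_root x y : x \in A -> y \in A -> x >=< y -> root e x = root e y.
  move=> xA yA xy; apply/eqP; rewrite root_connect //.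
  by apply: connect1; rewrite /= xA yA.
have isolated c : c \in A -> {in A, forall z, z != c -> z >< c} -> root e c = c.
  move=> cA iso; have cl : closed e (pred1 c).
    apply: (intro_closed csym) => x y /= /and3P[xA yA xy] /eqP xc.
    by apply: contraTT xy => yc; rewrite xc comparable_sym iso.
  by have := closed_connect cl (connect_root e c); rewrite !inE eqxx => /esym/eqP.
split=> [[cA n3]|[a [b [c [f [AE unq ab /andP[ac bc] /and3P[af bf cf]]]]]]].
  pose R := [set z in A | root e z == z].
  have cR : #|R| = 3.
    by rewrite -n3; apply: eq_card => z; rewrite !inE andbC.
  have RA : R \subset A by apply/subsetP => z; rewrite inE => /andP[].
  have /eqP/cards1P[b Ab] : #|A :\: R| = 1.
    by have := cardsD A R; rewrite (setIidPr RA) cA cR.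
  have /setDP[bA bR] : b \in A :\: R by rewrite Ab set11.
  set a := root e b; have aR : a \in R by rewrite inE rootA //= root_root.
  have /eqP/cards2P[c [f [cf Rcf]]] : #|R :\ a| = 2.
    by have := cardsD1 a R; rewrite aR cR => -[].
  have rR z : z \in R -> z \in A /\ root e z = z.
    by rewrite inE => /andP[? /eqP].
  have [aA ra] := rR a aR.
  have [ca /rR[cA' rc]] : c != a /\ c \in R.
    by apply/andP; rewrite -in_setD1 Rcf set21.
  have [fa /rR[fA rf]] : f != a /\ f \in R.
    by apply/andP; rewrite -in_setD1 Rcf set22.
  have inc x y : x \in A -> y \in A -> root e x != root e y -> x >< y.
    by move=> xA yA; apply: contraNN => /same_root->.
  have ac : a >< c by rewrite inc // ra rc eq_sym.
  have af : a >< f by rewrite inc // ra rf eq_sym.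
  have bc : b >< c by rewrite inc // -/a rc eq_sym.
  have bf : b >< f by rewrite inc // -/a rf eq_sym.
  have cf' : c >< f by rewrite inc // rc rf.
  have nab : a != b.
    by apply: contraNneq bR => eab; rewrite -eab.
  have nbc : b != c by apply: contraNneq bc => ->; rewrite comparablexx.
  have nbf : b != f by apply: contraNneq bf => ->; rewrite comparablexx.
  have AE : A = [set a; b; c; f].
    apply/setP=> z.
    have -> : (z \in A) = (z \in A :\: R) || (z \in a |: R :\ a).
      rewrite setD1K // in_setD; have [/(subsetP RA)->|_] := boolP (z \in R) => //.
      by rewrite orbF.
    by rewrite Ab Rcf !inE orbA [(z == b) || _]orbC -!orbA.
  have : a >=< b.
    apply: contraNT bR => iab; suff : a == b by move/eqP=> <-.
    apply/eqP/isolated => // z; rewrite AE !inE.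
    by move=> /orP[/orP[/orP[]|]|] /eqP->; rewrite ?eqxx // => _;
      rewrite comparable_sym.
  rewrite /Order.comparable !le_eqVlt (negPf nab) eq_sym (negPf nab) /=.
  case/orP=> [ab|ba].
    exists a, b, c, f; split=> //; rewrite ?ac ?af ?bc ?bf //=.
    by rewrite !inE !negb_or nab nbc nbf cf ![a == _]eq_sym ca fa.
  exists b, a, c, f; split=> //; rewrite ?ac ?af ?bc ?bf //=.
    by rewrite AE; apply/setP=> z; rewrite !inE [(z == a) || (z == b)]orbC.
  by rewrite !inE !negb_or nbc nbf cf ![a == _]eq_sym ca fa [b == a]eq_sym nab.
have [aA bA cA fA] : [/\ a \in A, b \in A, c \in A & f \in A].
  by rewrite AE !inE !eqxx !orbT.
have inA z : z \in A -> [\/ z = a, z = b, z = c | z = f].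
  rewrite AE !inE -!orbA.
  by case/or4P=> /eqP->; [constructor 1|constructor 2|constructor 3|constructor 4].
have rc : root e c = c.
  apply: isolated => // z /inA[]-> //; first by rewrite eqxx.
  by rewrite comparable_sym.
have rf : root e f = f.
  by apply: isolated => // z /inA[]-> //; rewrite eqxx.
have rb : root e b = root e a by rewrite (same_root a b) // lt_comparable.
(* The choice of representative in the two-element component is arbitrary. *)
have rab : root e a = a \/ root e a = b.
  have cl : closed e (pred2 a b).
    apply: (intro_closed csym) => x y /= /and3P[xA yA xy].
    rewrite !inE => /orP xab; case: (inA y yA) xy => ->; rewrite ?eqxx ?orbT //.
      by case: xab => /eqP->; rewrite (negPf ac, negPf bc).
    by case: xab => /eqP->; rewrite (negPf af, negPf bf).
  have := closed_connect cl (connect_root e a); rewrite !inE eqxx /=.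
  by move=> /esym/orP[]/eqP->; [left|right].
have cA4 : #|A| = 4.
  transitivity #|[:: a; b; c; f]|; last exact/card_uniqP.
  by apply: eq_card => z; rewrite AE !inE -!orbA.
split=> //; have nra g : g \in [:: c; f] -> root e a != g.
  move: unq; rewrite /= !inE !negb_or.
  by case/and4P=> /and3P[_ ? ?] /andP[? ?] _ _ /orP[]/eqP->; case: rab => ->.
transitivity #|[set root e a; c; f]|.
  apply: eq_card => z; rewrite !inE; apply/andP/idP.
    rewrite /roots /= => -[/eqP rz /inA zA].
    by rewrite -rz; case: zA => ->; rewrite ?rb ?rc ?rf eqxx ?orbT.
  move=> /orP[/orP[]|] /eqP->; rewrite /roots /= ?rc ?rf ?eqxx //.
  by rewrite root_root // eqxx rootA.
rewrite -setUA !cardsU1 cards1 !inE negb_or !nra ?inE ?eqxx ?orbT //.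
by move: unq; rewrite /= !inE andbT => /and3P[_ _ ->].
Qed.

End ThreeComponents.

(** * Blocks that need as many symbols as they have elements *)

Section WideBlocks.
Context {d : Order.disp_t} {P : finPOrderType d}.
Implicit Types A X Y : {set P}.
Local Open Scope order_scope.

(** No height is imposed, so the bound still applies after the symbols of the lower blocks have been
    removed. *)
Definition wide A : Prop := forall (U : finType) (S : P -> {set U}),
  subrep A S -> (#|A| <= #|\bigcup_(x in A) S x|)%N.

Lemma uniq_leq_card (T : finType) (s : seq T) (X : {set T}) :
  uniq s -> {subset s <= X} -> (size s <= #|X|)%N.
Proof.
by move=> /card_uniqP <- sub; apply/subset_leq_card/subsetP => x /sub.
Qed.

Lemma incomparableP A (U : finType) (S : P -> {set U}) x y : subrep A S ->
  x \in A -> y \in A -> ~~ (x <= y) -> exists2 u, u \in S x & u \notin S y.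
Proof. by move=> Srep xA yA; rewrite Srep // => /subsetPn. Qed.

(** The sets of the chain are nested, distinct and non-empty, an empty one being contained in [S t].
    Hence the largest has at least [#|C|] symbols, and [t] needs one outside it. *)
Lemma wide_in_B A : in_B A -> wide A.
Proof.
move=> [C [t [-> chC C2 tC inc]]] U S Srep.
have Crep : subrep C S by move=> x y xC yC; apply: Srep; rewrite !inE (xC, yC) orbT.
have [c0 c0C] : exists c, c \in C by apply/card_gt0P/ltnW.
have [c cC' maxc] := @arg_maxnP _ c0 (mem C) (fun c => #|S c|) c0C.
have {cC'}cC : c \in C by [].
have Sle x : x \in C -> S x \subset S c.
  move=> xC; have := chC x c xC cC; rewrite /Order.comparable !Crep //.
  case/orP=> // cx; have : S c == S x by rewrite eqEcard cx; apply: maxc.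
  by move=> /eqP->.
have Spos x : x \in C -> (0 < #|S x|)%N.
  move=> xC; rewrite card_gt0; apply/eqP => Sx; case/negP: (inc x xC).
  by rewrite le_comparable // Srep ?inE ?eqxx ?xC ?orbT // Sx sub0set.
have C_le : (#|C| <= #|S c|)%N.
  have lt x : x \in C -> (#|S x|.-1 < #|S c|)%N.
    by move=> xC; rewrite prednK ?Spos // subset_leq_card ?Sle.
  rewrite -[X in (_ <= X)%N]card_ord.
  (* Sizes are shifted down by one because no set is empty; the default of [insubd] is never reached
     on [C]. *)
  pose f x := insubd (Ordinal (lt c cC)) #|S x|.-1.
  rewrite -(@card_in_imset _ _ f) ?max_card // => x y xC yC /(congr1 val).
  rewrite !val_insubd !lt // => /(congr1 succn); rewrite !prednK ?Spos // => e.
  have := chC x y xC yC; rewrite /Order.comparable !Crep // => /orP[] sub.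
    by apply/eqP; rewrite eq_le !Crep // sub /= subEproper eq_sym eqEcard sub e leqnn.
  by apply/eqP; rewrite eq_le !Crep // sub /= andbT subEproper eq_sym eqEcard sub e leqnn.
have [u ut uc] : exists2 u, u \in S t & u \notin S c.
  apply: (incomparableP Srep); rewrite ?in_setU1 ?eqxx ?cC ?orbT //.
  apply/negP => tlec; case/negP: (inc c cC).
  by rewrite comparable_sym le_comparable.
rewrite cardsU1 tC add1n; apply: leq_ltn_trans C_le _.
apply/proper_card/properP; split.
  by apply: bigcup_sup; rewrite !inE cC orbT.
by exists u => //; apply/bigcupP; exists t => //; rewrite !inE eqxx.
Qed.

(** Symbols are counted relative to [S b]. Two outside it suffice, as [k] and [r] are inside; three
    inside suffice, as [u] is outside. *)
Lemma wide_Zshape A : Zshape A -> wide A.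
Proof.
move=> [a [b [c [e [AE unq ab /andP[ac bc] /and3P[ae be ce]]]]]] U S Srep.
have [aA bA cA eA] : [/\ a \in A, b \in A, c \in A & e \in A].
  by rewrite AE !inE !eqxx !orbT.
have -> : #|A| = 4.
  transitivity #|[:: a; b; c; e]|; last exact/card_uniqP.
  by apply: eq_card => z; rewrite AE !inE -!orbA.
set V := \bigcup_(x in A) S x.
have inV x u : x \in A -> u \in S x -> u \in V by move=> xA ux; apply/bigcupP; exists x.
have sep x y : x \in A -> y \in A -> (x >< y) ->
    (exists2 u, u \in S x & u \notin S y) /\ (exists2 u, u \in S y & u \notin S x).
  move=> xA yA; rewrite /Order.comparable negb_or => /andP[xy yx].
  by split; apply: incomparableP Srep _ _ _.
have [[s sc se] [t te tc]] := sep c e cA eA ce.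
have [_ [u uc ub]] := sep b c bA cA bc.
have [_ [v ve vb]] := sep b e bA eA be.
have [[k ka kc] _] := sep a c aA cA ac.
have [[l la le] _] := sep a e aA eA ae.
have ab_sub : S a \subset S b by rewrite -Srep // ltW.
have [r rb ra] : exists2 r, r \in S b & r \notin S a.
  by apply: (incomparableP Srep) => //; rewrite lt_geF.
have kb := subsetP ab_sub k ka; have lb := subsetP ab_sub l la.
have ne (X : {set U}) x y : x \in X -> y \notin X -> x <> y.
  by move=> xX yX e'; move: yX; rewrite -e' xX.
have four x1 x2 x3 x4 : x1 <> x2 -> x1 <> x3 -> x1 <> x4 -> x2 <> x3 ->
    x2 <> x4 -> x3 <> x4 -> [/\ x1 \in V, x2 \in V, x3 \in V & x4 \in V] ->
    (4 <= #|V|)%N.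
  move=> /eqP n12 /eqP n13 /eqP n14 /eqP n23 /eqP n24 /eqP n34 [V1 V2 V3 V4].
  apply: (@uniq_leq_card _ [:: x1; x2; x3; x4]).
    by rewrite /= !inE !negb_or n12 n13 n14 n23 n24 n34.
  by move=> z; rewrite !inE => /or4P[]/eqP->.
have kr : k <> r := ne _ _ _ ka ra.
have lr : l <> r := ne _ _ _ la ra.
have two x y : x \in V -> y \in V -> x <> y -> x \notin S b -> y \notin S b ->
    (4 <= #|V|)%N.
  move=> xV yV xy xb yb; apply: (four x y k r) => //; try exact/nesym/(ne (S b)).
  by split=> //; [apply: (inV a)|apply: (inV b)].
have three x y z : x \in S b -> y \in S b -> z \in S b -> x <> y -> x <> z ->
    y <> z -> (4 <= #|V|)%N.
  move=> xb yb zb xy xz yz; apply: (four x y z u) => //; try exact: (ne (S b)).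
  by split; [apply: (inV b)|apply: (inV b)|apply: (inV b)|apply: (inV c)].
have sV : s \in V := inV c s cA sc. have tV : t \in V := inV e t eA te.
have uV : u \in V := inV c u cA uc. have vV : v \in V := inV e v eA ve.
have [sb|sb] := boolP (s \in S b); last first.
  by apply: (two s v) => //; apply/nesym/(ne (S e)).
have [tb|tb] := boolP (t \in S b); last first.
  by apply: (two t u) => //; apply/nesym/(ne (S c)).
have st : s <> t := ne _ _ _ sc tc.
have sk : s <> k := ne _ _ _ sc kc.
have tl : t <> l := ne _ _ _ te le.
(* In the remaining case [k = t] and [l = s] both lie in [S a], and [r] is the third symbol of
   [S b]. *)
have [kt|/eqP kt] := eqVneq k t; last by apply: (three s t k) => //; apply/nesym.
have [ls|/eqP ls] := eqVneq l s; last by apply: (three s t l) => //; apply/nesym.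
by apply: (three s t r) => //; [rewrite -ls|rewrite -kt].
Qed.

(** The sets are neither empty nor full. With at most three symbols such subsets are covered by as
    many chains as there are symbols, and each chain holds at most one member of the antichain; with
    four or more, [#|A| <= 4] suffices. *)
Lemma wide_in_A234 A : in_A234 A -> wide A.
Proof.
case=> acA /andP[A2 A4] U S Srep.
set V := \bigcup_(x in A) S x.
have VE := mem_enum V; have := cardE V.
have other x : x \in A -> exists y, [/\ y \in A, ~~ (x <= y) & ~~ (y <= x)].
  move=> xA; have /card_gt0P[y] : (0 < #|A :\ x|)%N.
    by have := cardsD1 x A; rewrite xA; lia.
  rewrite !inE => /andP[yx yA]; exists y; split=> //; apply: contraNN yx.
    by move/(acA x y xA yA)->.
  by move/(acA y x yA xA)->.
have SV x : x \in A -> {subset S x <= enum V}.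
  by move=> xA u ux; rewrite VE; apply/bigcupP; exists x.
move: (enum V) VE SV => l VE SV ->.
have SE x y : x \in A -> (S x \subset S y) = all (fun u => (u \in S x) ==> (u \in S y)) l.
  move=> xA; apply/subsetP/allP => [sub u _|sub u ux]; first exact/implyP/sub.
  by have /implyP := sub u (SV x xA u ux); apply.
(* The code [f x] names the chain that contains [S x]. *)
have code k (f : P -> nat) : {in A, forall x, (f x < k)%N} ->
    {in A &, forall x y, f x = f y -> (S x \subset S y) || (S y \subset S x)} ->
    (#|A| <= k)%N.
  move=> fk finj; rewrite -[X in (_ <= X)%N]card_ord.
  have [x0 x0A] : exists x, x \in A by apply/card_gt0P/ltnW.
  pose g x := insubd (Ordinal (fk x0 x0A)) (f x).
  rewrite -(@card_in_imset _ _ g) ?max_card // => x y xA yA /(congr1 val).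
  rewrite !val_insubd !fk // => /(finj _ _ xA yA); rewrite -!Srep //.
  by case/orP=> [/acA->|/acA->].
have S0 x : x \in A -> has (fun u => u \in S x) l.
  move=> xA; have [y [yA + _]] := other x xA; rewrite Srep // SE // => /allPn[u ul].
  by rewrite negb_imply => /andP[ux _]; apply/hasP; exists u.
have S1 x : x \in A -> ~~ all (fun u => u \in S x) l.
  move=> xA; have [y [yA _]] := other x xA; rewrite Srep // SE // => /allPn[u ul].
  by rewrite negb_imply => /andP[_ ux]; apply/allPn; exists u.
case: l VE SV SE S0 S1 => [|u [|v [|w [|z l]]]] VE SV SE S0 S1 //=.
- have [x0 x0A] : exists x, x \in A by apply/card_gt0P/ltnW.
  by have := S0 x0 x0A.
- by apply: (code _ (fun=> 0)) => // x y xA yA _; move: (S0 x xA) (S1 x xA) => /=;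
    case: (u \in S x).
- apply: (code _ (fun x => ~~ (u \in S x))) => [x xA|x y xA yA].
    by case: (u \in S x).
  rewrite !SE //=; move: (S0 x xA) (S1 x xA) (S0 y yA) (S1 y yA) => /=.
  by case: (u \in S x); case: (v \in S x); case: (u \in S y); case: (v \in S y).
(* The non-trivial subsets of {u, v, w} are covered by the three chains
   {u} < {u, v}, {v} < {v, w} and {w} < {u, w}. *)
- apply: (code _ (fun x => if u \in S x then if w \in S x then 2 else 0
                           else if v \in S x then 1 else 2)) => [x xA|x y xA yA].
    by do !case: ifP.
  rewrite !SE //=; move: (S0 x xA) (S1 x xA) (S0 y yA) (S1 y yA) => /=.
  case: (u \in S x); case: (v \in S x); case: (w \in S x) => //;
    case: (u \in S y); case: (v \in S y); case: (w \in S y) => //.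
by apply: leq_trans A4 _.
Qed.

Lemma wide_step X Y (U : finType) (S : P -> {set U}) : inclusion_rep S ->
  {in X & Y, forall x y, x < y} ->
  (#|X| <= #|\bigcup_(x in X) S x|)%N ->
  (#|Y| <= #|\bigcup_(y in Y) (S y :\: \bigcup_(x in X) S x)|)%N ->
  (#|X :|: Y| <= #|\bigcup_(x in X :|: Y) S x|)%N.
Proof.
move=> Srep XY lX lY; set N := \bigcup_(x in X) S x in lX lY.
set M := \bigcup_(y in Y) (S y :\: N) in lY.
apply: leq_trans (leq_card_setU _ _) _; apply: leq_trans (leq_add lX lY) _.
have dj : [disjoint N & M].
  rewrite disjoint_sym disjoint_subset; apply/subsetP => u /bigcupP[y _].
  by rewrite !inE => /andP[].
have <- : #|N :|: M| = (#|N| + #|M|)%N.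
  by apply/eqP; rewrite (leq_card_setU N M).2.
apply/subset_leq_card/subsetP => u; rewrite in_setU => /orP[] /bigcupP[x xX ux].
  by apply/bigcupP; exists x; rewrite // inE xX.
by apply/bigcupP; exists x; [rewrite inE xX orbT|move: ux; rewrite inE => /andP[]].
Qed.

(** Each [S y] contains every symbol used on [X], so removing these symbols preserves and reflects
    inclusion. *)
Lemma subrep_above X Y (U : finType) (S : P -> {set U}) : inclusion_rep S ->
  {in X & Y, forall x y, x < y} ->
  subrep Y (fun y => S y :\: \bigcup_(x in X) S x).
Proof.
move=> Srep XY y z yY zY; rewrite Srep; apply/idP/idP => [|sub]; first exact: setSD.
apply/subsetP => u uy; have [/bigcupP[x xX ux]|uN] := boolP (u \in \bigcup_(x in X) S x).
  by apply: subsetP ux; rewrite -Srep ltW // XY.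
by have := subsetP sub u; rewrite !in_setD uN uy => /(_ isT).
Qed.

Lemma wide_sum (Q : seq {set P}) (U : finType) (S : P -> {set U}) :
  inclusion_rep S ->
  pairwise (fun B C : {set P} => [forall x in B, forall y in C, x < y]) Q ->
  {in Q, forall B, wide B} ->
  (#|\bigcup_(B <- Q) B| <= #|\bigcup_(x in \bigcup_(B <- Q) B) S x|)%N.
Proof.
move=> Srep; elim/last_ind: Q => [|Q B IH]; first by rewrite big_nil cards0.
rewrite pairwise_rcons => /andP[/allP QB pQ] wQ.
have lt : {in \bigcup_(C <- Q) C & B, forall x y, x < y}.
  move=> x y; rewrite bigcup_seq => /bigcupP[C CQ xC] yB.
  by have /forall_inP/(_ x xC)/forall_inP/(_ y yB) := QB C CQ.
rewrite big_rcons /= ; apply: wide_step => //.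
  by apply: IH => // C CQ; apply: wQ; rewrite mem_rcons inE CQ orbT.
by apply: wQ; [rewrite mem_rcons mem_head|apply: subrep_above].
Qed.

(** With two or more elements no set is empty, so all are distinct singletons. This serves a top
    antichain of arbitrary size. *)
Lemma antichain_card A (U : finType) (S : P -> {set U}) :
  in_A A -> subrep A S -> {in A, forall x, (#|S x| <= 1)%N} ->
  (#|A| <= #|\bigcup_(x in A) S x|)%N.
Proof.
move=> [acA A2] Srep S1.
rewrite -(@card_in_imset _ _ S A) => [|x y xA yA e]; last first.
  by apply: acA => //; rewrite Srep // e.
apply: leq_trans (leq_imset_card (@set1 U) _); apply/subset_leq_card/subsetP.
move=> _ /imsetP[x xA ->]; have /cards1P[u Su] : #|S x| == 1%N.
  rewrite eqn_leq S1 //= card_gt0; apply/eqP => Sx0.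
  have /card_gt0P[y] : (0 < #|A :\ x|)%N.
    by have := cardsD1 x A; rewrite xA; lia.
  rewrite !inE => /andP[/eqP yx yA]; apply/yx/esym/acA => //.
  by rewrite Srep // Sx0 sub0set.
rewrite Su; apply: imset_f; apply/bigcupP; exists x => //.
by rewrite Su set11.
Qed.

End WideBlocks.

(** * Extending a recoding of a block to all of [P] *)

Section Gluing.
Context {d : Order.disp_t} {P : finPOrderType d}.
Implicit Types A B C : {set P}.
Local Open Scope order_scope.

Lemma shrinkable_cw : cw P = #|P| -> ~ shrinkable [set: P].
Proof.
move=> cwP [w [S [_ Sw Srep Sh]]].
have rep : inclusion_rep S by move=> x y; apply: Srep; rewrite inE.
have hS x : (#|S x| <= ch P)%N.
  have [y _ hy] := Sh x (in_setT x); apply: leq_trans hy _.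
  apply: leq_trans (downset_le_ch y cwP); apply/subset_leq_card/subsetP => z.
  by rewrite !inE.
have sub : \bigcup_x S x \subset [set: P] :\ w.
  by apply/bigcupsP => x _; apply: Sw.
have := leq_trans (cw_min rep hS) (subset_leq_card sub).
by rewrite cwP leqNgt -cardsT proper_card // properD1.
Qed.

Lemma irreducible_block A :
  ~ (exists B C, vertical_sum A [:: B; C]) -> irreducible A.
Proof.
move=> nvs L LA L0 lt; apply/eqP; apply: contraT => nLA; case: nvs.
exists L, (A :\: L); apply/vertical_sumP; split.
- by rewrite big_cons big_seq1 -{1}(setID A L) (setIidPr LA).
- rewrite !inE negb_or eq_sym L0 eq_sym setD_eq0.
  by apply: contra nLA => AL; rewrite eqEsubset LA.
rewrite /= !andbT; apply/forall_inP => x xL; apply/forall_inP => y.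
by rewrite inE => /andP[yL yA]; apply: lt.
Qed.

Lemma card_chain A : is_chain A \/ (1 < #|A|)%N.
Proof.
have [?|lt] := ltnP 1 #|A|; [by right|left=> x y xA yA].
by rewrite (card_le1_eqP lt x y) // comparablexx.
Qed.

Definition homogeneous A : Prop := forall x, x \notin A ->
  {in A, forall a, x < a} \/ {in A, forall a, a < x}.

(** Members of [A] keep the outside part of their down-set and use [S] inside; all other elements
    keep their down-set without [w]. Height is measured in all of [P], so that an element above [A]
    can supply it. *)
Lemma glue A w (S : P -> {set P}) : homogeneous A -> irreducible A ->
  (1 < #|A|)%N -> w \in A -> {in A, forall x, S x \subset A :\ w} ->
  subrep A S ->
  {in A, forall x, exists y, (#|(dn [set: P] x :\: A) :|: S x| <= #|dn [set: P] y|)%N} ->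
  shrinkable [set: P].
Proof.
move=> homA irrA A2 wA Sw Srep Sh.
(* An empty [S x] would make [x] the bottom of [A], against irreducibility. A symbol in [A]
   separates [x] from the elements below [A]. *)
have S0 x : x \in A -> exists2 s, s \in S x & s \in A.
  move=> xA; have [Sx0|[s sx]] := set_0Vmem (S x); last first.
    by exists s => //; have := subsetP (Sw x xA) s sx; rewrite inE => /andP[].
  have x1A : [set x] = A.
    apply: irrA; rewrite ?sub1set //; first by rewrite -card_gt0 cards1.
    move=> _ y /set1P-> yA; rewrite inE eq_sym => xy; rewrite lt_neqAle xy.
    by rewrite Srep // Sx0 sub0set.
  by move: A2; rewrite -x1A cards1.
pose T x := if x \in A then (dn [set: P] x :\: A) :|: S x else dn [set: P] x :\ w.
have TA x : x \in A -> T x = (dn [set: P] x :\: A) :|: S x by rewrite /T => ->.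
have TN x : x \notin A -> T x = dn [set: P] x :\ w by rewrite /T => /negPf->.
have SA x z : x \in A -> z \in S x -> (z \in A) && (z != w).
  by move=> xA /(subsetP (Sw x xA)); rewrite !inE andbC.
exists w, T; split; first by rewrite inE.
- move=> x _; apply/subsetP => z; rewrite !inE andbT.
  have [xA|xA] := boolP (x \in A); last by rewrite TN // !inE => /andP[].
  rewrite TA // !inE => /orP[/andP[zA _]|/(SA _ _ xA)/andP[]//].
  by apply: contraNneq zA => ->.
- move=> x y _ _; have [xA|xA] := boolP (x \in A); have [yA|yA] := boolP (y \in A).
  + rewrite !TA //; apply/idP/subsetP => [xy z|sub].
      rewrite !inE => /orP[/andP[-> /le_trans->//]|zx]; apply/orP; right.
      by apply: subsetP zx; rewrite -Srep.
    rewrite Srep //; apply/subsetP => z zx; have /andP[zA _] := SA _ _ xA zx.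
    by have := sub z; rewrite !inE zx zA orbT => /(_ isT).
  + rewrite (TA x) // (TN y) //; have [ya|ay] := homA y yA.
      rewrite lt_geF ?ya //; apply/esym/negbTE/subsetPn.
      have [s sx sA] := S0 x xA; exists s; rewrite !inE ?sx ?orbT //.
      by rewrite lt_geF ?andbF // ya.
    rewrite ltW ?ay //; apply/esym/subsetP => z; rewrite !inE.
    case/orP=> [/andP[zA zx]|/(SA _ _ xA)/andP[zA ->]]; last by rewrite ltW ?ay.
    rewrite (le_trans zx) ?ltW ?ay //= andbT.
    by apply: contraNneq zA => ->.
  + rewrite (TN x) // (TA y) //; have [xa|ax] := homA x xA.
      rewrite ltW ?xa //; apply/esym/subsetP => z; rewrite !inE.
      case/andP=> _ zx; rewrite (le_trans zx) ?ltW ?xa //= andbT.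
      by apply/orP; left; apply/negP => /xa/(le_lt_trans zx); rewrite ltxx.
    rewrite lt_geF ?ax //; apply/esym/negbTE/subsetPn; exists x.
      by rewrite !inE lexx /= andbT; apply: contraNneq xA => ->.
    rewrite !inE xA /= lt_geF ?ax //=; apply/negP => /(SA _ _ yA).
    by rewrite (negPf xA).
  + rewrite !TN //; apply/idP/subsetP => [xy z|sub].
      by rewrite !inE => /andP[-> /le_trans->].
    have xw : x != w by apply: contraNneq xA => ->.
    by have := sub x; rewrite !inE lexx xw => /(_ isT)/andP[].
move=> x _; have [xA|xA] := boolP (x \in A).
  by have [y hy] := Sh x xA; exists y; rewrite ?inE // TA.
by exists x; rewrite ?inE // TN //; apply/subset_leq_card/subsetDl.
Qed.

Lemma glue_shrinkable A : homogeneous A -> irreducible A -> (1 < #|A|)%N ->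
  shrinkable A -> shrinkable [set: P].
Proof.
move=> homA irrA A2 [w [S [wA Sw Srep Sh]]].
apply: (glue homA irrA A2 wA Sw Srep) => x xA; have [y yA hy] := Sh x xA.
exists y; apply: leq_trans (leq_card_setU _ _) _.
(* By homogeneity, every element outside [A] below [x] is also below [y], so only the parts inside
   [A] need comparing. *)
rewrite -(cardsID A (dn [set: P] y)) addnC; apply: leq_add.
  apply: leq_trans hy _; apply/subset_leq_card/subsetP => z.
  by rewrite !inE andbC.
apply/subset_leq_card/subsetP => z; rewrite !inE => /andP[zA zx]; rewrite zA /=.
by have [za|az] := homA z zA; [rewrite ltW ?za|rewrite lt_geF ?az in zx].
Qed.

(* Five of the elements become distinct 2-subsets of a 4-set. *)
Lemma shrink_antichain A j : homogeneous A -> irreducible A -> in_A A ->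
  (4 < #|A|)%N -> {in A, forall a, a < j} -> shrinkable [set: P].
Proof.
move=> homA irrA [acA A2] A5 Aj.
have [a [b [c [e [f [unq sub]]]]]] : exists a b c e f : P,
    uniq [:: a; b; c; e; f] /\ {subset [:: a; b; c; e; f] <= A}.
  have := enum_uniq A; have : {subset enum A <= A} by move=> z; rewrite mem_enum.
  move: A5; rewrite cardE; case: (enum A) => [|a [|b [|c [|e [|f l]]]]] // _ sub unq.
  exists a, b, c, e, f; split; last first.
    by move=> z zl; apply: sub; rewrite (mem_cat z [:: a; b; c; e; f] l) zl.
  by have := take_uniq 5 unq; rewrite /= take0.
have [aA bA cA eA fA] : [/\ a \in A, b \in A, c \in A, e \in A & f \in A].
  by split; apply: sub; rewrite !inE eqxx ?orbT.
pose S z := if z == a then [set a; b] else if z == b then [set a; c]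
  else if z == c then [set a; e] else if z == e then [set b; c]
  else if z == f then [set b; e] else [set z].
move: unq; rewrite /= !inE !negb_or.
case/and5P=> /and4P[ab ac ae af] /and3P[bc be bf] /andP[ce cf] ef _.
have SP z : [\/ [\/ z = a /\ S z = [set a; b], z = b /\ S z = [set a; c] |
                 z = c /\ S z = [set a; e]],
    z = e /\ S z = [set b; c], z = f /\ S z = [set b; e] |
    z \notin [:: a; b; c; e; f] /\ S z = [set z]].
  rewrite /S !inE; have [->|za] := eqVneq z a; first by constructor 1; constructor 1.
  have [->|zb] := eqVneq z b; first by constructor 1; constructor 2.
  have [->|zc] := eqVneq z c; first by constructor 1; constructor 3.
  have [->|ze] := eqVneq z e; first by constructor 2.
  by have [->|zf] := eqVneq z f; [constructor 3|constructor 4].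
have SA z : z \in A -> S z \subset A :\ f.
  move=> zA; case: (SP z) => [[]|||] [nz ->];
    try (by rewrite subUset !sub1set !inE ?aA ?bA ?cA ?eA ?af ?bf ?cf ?ef).
  rewrite sub1set !inE zA andbT; apply: contraNneq nz => ->.
  by rewrite !inE eqxx !orbT.
apply: (@glue A f S) => //.
  move=> x y xA yA; apply/idP/idP => [/acA->//|].
  have [->|xy] := eqVneq x y; first by rewrite lexx.
  have N := (negPf ab, negPf ac, negPf ae, negPf af, negPf bc, negPf bf,
             negPf be, negPf ce, negPf cf, negPf ef).
  have N' := (eq_sym b a, eq_sym c a, eq_sym e a, eq_sym f a, eq_sym c b,
              eq_sym e b, eq_sym f b, eq_sym e c, eq_sym f c, eq_sym f e).
  (* Two cases of the inclusion test: a pair does not fit into a singleton, and an element outside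
     the five is not a symbol of any pair. *)
  have one p q : p == q = false -> [set p; q] \subset [set y] -> x <= y.
    move=> pq; rewrite subUset !sub1set !inE => /andP[/eqP pe /eqP qe].
    by rewrite pe qe eqxx in pq.
  have in5 : x \notin [:: a; b; c; e; f] -> y \in [:: a; b; c; e; f] ->
      forall p q, p \in [:: a; b; c; e; f] -> q \in [:: a; b; c; e; f] ->
      [set x] \subset [set p; q] -> x <= y.
    move=> nx _ p q pl ql; rewrite sub1set in_set2.
    by case/orP=> /eqP xe; rewrite xe ?pl ?ql in nx.
  case: (SP x) => [[]|||] [xe ->]; case: (SP y) => [[]|||] [ye ->];
    try (by move: xy; rewrite xe ye eqxx);
    try (by apply: one; rewrite ?N' N);
    try (by apply: in5 => //; rewrite ?ye !inE eqxx ?orbT);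
    try (by rewrite subUset !sub1set !inE ?N' ?N ?eqxx).
  by rewrite sub1set inE (negPf xy).
(* The down-set of [j] contains all of [A] and everything below it, which leaves room for the
   pairs. *)
move=> x xA; exists j; apply/subset_leq_card/subsetP => z; rewrite !inE.
case/orP=> [/andP[_ zx]|/(subsetP (SA x xA))].
  by rewrite (le_trans zx) ?ltW ?Aj.
by rewrite !inE => /andP[_ zA]; rewrite ltW ?Aj.
Qed.

(** A lowest element [c] comparable with everything is the join of its strict down-set: an upper
    bound [y < c] of that set would itself be comparable with everything. So the symbol [c] could be
    saved. *)
Lemma no_cut (x : P) : cw P = #|P| -> ~ (forall y : P, x >=< y).
Proof.
move=> cwP cutx; pose cut x := [forall y : P, x >=< y].
have cx : cut x by apply/forallP.
have [c /forallP cutc minc] := @arg_minnP _ x cut (fun x => #|sdn [set: P] x|) cx.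
apply: (shrinkable_cw cwP); apply: (@shrink_join _ _ _ c); rewrite ?inE //.
move=> y _ /subsetP sub; have := cutc y; rewrite /Order.comparable => /orP[//|yc].
have [->//|nyc] := eqVneq y c; have {nyc}yc : y < c by rewrite lt_neqAle nyc.
have le_y z : z < c -> z <= y by move=> zc; have := sub z; rewrite !inE zc => /(_ isT).
have /minc : cut y.
  apply/forallP => z; have := cutc z; rewrite /Order.comparable le_eqVlt.
  case/orP=> [/orP[/eqP<-|cz]|]; first by rewrite ltW.
    by rewrite ltW ?(lt_trans yc).
  by rewrite le_eqVlt => /orP[/eqP->|/le_y->]; rewrite ?orbT // ltW.
rewrite leqNgt => /negP[]; apply/proper_card/properP; split.
  by apply/subsetP => z; rewrite !inE => /lt_trans->.
by exists y; rewrite !inE ?ltxx.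
Qed.

End Gluing.

(** * Vertical sums of blocks and the characterization *)

Section BlockSums.
Context {d : Order.disp_t} {P : finPOrderType d}.
Implicit Types (A B C X Y : {set P}) (Q : seq {set P}).
Local Open Scope order_scope.

Lemma sum_of_block_decomposition Q : (0 < #|P|)%N -> block_decomposition Q ->
  sum_of_blocks [set: P] Q.
Proof.
move=> P0 [[blP ->]|[_ []//]]; split=> [|B]; last by rewrite inE => /eqP->.
apply/vertical_sumP; rewrite big_seq1; split=> //.
by rewrite inE eq_sym -card_gt0 cardsT.
Qed.

Lemma sum_homogeneous Q i : vertical_sum [set: P] Q -> (i < size Q)%N ->
  homogeneous (nth set0 Q i).
Proof.
move=> /vertical_sumP[QT _ /(pairwiseP set0) pQ] iQ x xi.
have : x \in [set: P] by rewrite inE.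
rewrite QT (big_nth set0) big_mkord => /bigcupP[[j jQ] _ /= xj].
case: (ltngtP i j) => [ij|ji|ij]; last by rewrite -ij (negPf xi) in xj.
  right=> a ai.
  by have /forall_inP/(_ a ai)/forall_inP/(_ x xj) := pQ _ _ iQ jQ ij.
left=> a ai.
by have /forall_inP/(_ x xj)/forall_inP/(_ a ai) := pQ _ _ jQ iQ ji.
Qed.

Lemma block_of_tight_sum Q B : cw P = #|P| -> sum_of_blocks [set: P] Q ->
  B \in Q ->
  [/\ homogeneous B, irreducible B, (1 < #|B|)%N &
      in_A B \/ in_B B \/ in_Z B].
Proof.
move=> cwP [sQ bQ] BQ; have [_ Q0 _] := (vertical_sumP _ _).1 sQ.
have homB : homogeneous B.
  by rewrite -(nth_index set0 BQ); apply: sum_homogeneous; rewrite ?index_mem.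
(* An element of a chain block would be comparable with all of [P]. *)
have nchain : ~ is_chain B.
  move=> chB; have [B0|[x xB]] := set_0Vmem B; first by rewrite B0 (negPf Q0) in BQ.
  apply: (@no_cut _ _ x cwP) => y; have [yB|yB] := boolP (y \in B); first exact: chB.
  have [lt|lt] := homB y yB; last by rewrite lt_comparable ?lt.
  by rewrite comparable_sym lt_comparable ?lt.
have irrB : irreducible B by apply: irreducible_block; case: (bQ B BQ).
have [//|B2] := card_chain B; split=> //.
have nsh : ~ shrinkable B by move/(glue_shrinkable homB irrB B2)/(shrinkable_cw cwP).
case: (irreducible_classes irrB B2 nsh) => [?|?|/in_ZP ?]; first by left.
  by right; left.
by right; right.
Qed.

(** Below a top antichain the down-sets have at most [#|X| + 1] elements, which bounds [ch P]. Each
    [S y] already contains the at least [#|X|] symbols used on [X], so at most one is left for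
    [y]. *)
Lemma card_last_antichain X Y (U : finType) (S : P -> {set U}) :
  X :|: Y = [set: P] -> {in X & Y, forall x y, x < y} -> in_A Y ->
  inclusion_rep S -> (forall x, (#|S x| <= ch P)%N) ->
  (#|X| <= #|\bigcup_(x in X) S x|)%N ->
  (#|Y| <= #|\bigcup_(y in Y) (S y :\: \bigcup_(x in X) S x)|)%N.
Proof.
move=> XYT XY inAY Srep Sch lX; set N := \bigcup_(x in X) S x in lX *.
have [acY _] := inAY.
apply: antichain_card => //; first exact: subrep_above.
move=> y yY; have : (#|S y| <= #|X|.+1)%N.
  apply: leq_trans (Sch y) _.
  apply: (@ch_min _ _ _ (fun x => [set z : P | z <= x])).
    move=> x z; apply/idP/subsetP => [xz t|/(_ x)]; last by rewrite !inE lexx => ->.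
    by rewrite !inE => /le_trans; apply.
  move=> x; have sub : [set z : P | z <= x] \subset x |: X.
    apply/subsetP => z; rewrite !inE => zx.
    have : z \in X :|: Y by rewrite XYT inE.
    rewrite inE => /orP[->|zY]; first by rewrite orbT.
    have : x \in X :|: Y by rewrite XYT inE.
    rewrite inE => /orP[xX|xY]; first 
      by have := lt_le_trans (XY x z xX zY) zx; rewrite ltxx.
    by rewrite (acY z x) ?eqxx.
  apply: leq_trans (subset_leq_card sub) _; rewrite cardsU1.
  by case: (x \in X); rewrite ?add0n ?add1n.
have sub : N \subset S y.
  by apply/bigcupsP => x xX; rewrite -Srep ltW // XY.
by have := cardsD (S y) N; rewrite (setIidPr sub); lia.
Qed.

End BlockSums.

Theorem theorem5p2 (d : Order.disp_t) (P : finPOrderType d) (hP : 0 < #|P|)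
    (Q : seq {set P}) (hQ : block_decomposition Q) :
  cw P = #|P| <->
  (let t := size Q in
   let Qt := nth set0 Q t.-1 in
   (in_A Qt \/ in_B Qt \/ in_Z Qt) /\
   (1 < t -> forall i, i < t.-1 ->
      let Qi := nth set0 Q i in in_A234 Qi \/ in_B Qi \/ in_Z Qi)).
Proof.
have sumQ := sum_of_block_decomposition hP hQ.
have [/[dup] sQ /vertical_sumP[QT Q0 pQ] bQ] := sumQ.
have Qgt0 : 0 < size Q.
  case: (Q) QT => // QT; move: hP; rewrite -cardsT.
  by rewrite QT big_nil cards0.
cbv zeta; split=> [cwP|[inQt inQi]].
  split=> [|Q1 i it].
    by have [] := block_of_tight_sum cwP sumQ (mem_nth set0 (_ : (size Q).-1 < size Q));
      rewrite ?ltn_predL.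
  have iQ : i < size Q by rewrite (leq_trans it) ?leq_pred.
  have [homA irrA A2 inA] := block_of_tight_sum cwP sumQ (mem_nth set0 iQ).
  case: inA => [inA|]; last by right.
  left; case: (inA) => acA _; split=> //; rewrite A2 leqNgt; apply/negP => A5.
  apply: (shrinkable_cw cwP).
  have tQ : (size Q).-1 < size Q by rewrite ltn_predL.
  (* Any element [j] of the top block gives the height needed to recode a lower antichain of five or
     more elements. *)
  have [Qt0|[j jt]] := set_0Vmem (nth set0 Q (size Q).-1).
    by case/negP: Q0; rewrite -Qt0 mem_nth.
  apply: (@shrink_antichain _ _ _ j homA irrA inA A5) => a ai.
  have := (pairwiseP set0 pQ) i (size Q).-1 iQ tQ it.
  by move=> /forall_inP/(_ a ai)/forall_inP/(_ j jt).
apply/eqP; rewrite eqn_leq cw_le_card /=.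
have [U [S [Srep Sch <-]]] := @cw_attained _ P.
have -> : \bigcup_x S x = \bigcup_(x in [set: P]) S x.
  by apply: eq_bigl => x; rewrite inE.
rewrite -cardsT.
(* The top block is split off: it alone may be a large antichain, whose bound depends on the height,
   whereas all lower blocks are [wide]. *)
case/lastP: Q {hQ sumQ sQ bQ Q0} Qgt0 QT pQ inQt inQi => // Q B _ QT pQ.
rewrite size_rcons /= nth_rcons ltnn eqxx => inB inQ.
move: QT pQ; rewrite big_rcons /= pairwise_rcons => QT /andP[/allP QB pQ].
have lt : {in \bigcup_(C <- Q) C & B, forall x y, (x < y)%O}.
  move=> x y; rewrite bigcup_seq => /bigcupP[C CQ xC] yB.
  by have /forall_inP/(_ x xC)/forall_inP/(_ y yB) := QB C CQ.
have wideQ : {in Q, forall C, wide C}.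
  move=> C CQ; have iQ : index C Q < size Q by rewrite index_mem.
  have := inQ (leq_ltn_trans (leq0n _) iQ) _ iQ; rewrite nth_rcons iQ nth_index //.
  case=> [/wide_in_A234//|[/wide_in_B//|/in_ZP/wide_Zshape//]].
have leX := wide_sum Srep pQ wideQ.
rewrite QT; apply: wide_step => //; case: inB => [inA|[/wide_in_B wB|/in_ZP/wide_Zshape wB]].
- exact: card_last_antichain.
- by apply: wB; apply: subrep_above.
- by apply: wB; apply: subrep_above.
Qed.
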